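(* Let $s\ge 2$ be an integer, let $k_1,\ldots,k_n$ be odd positive integers, and let $X$ be a subcomplex of the minimal CW structure on $\mathbb{S}(k_1,\ldots,k_n)=S^{k_1}\times\cdots\times S^{k_n}$. Then $$\mathrm{TC}_s(X)=\mathrm{N}^s(X).$$
   Context: Cell structure: each sphere $S^{k_i}$ has the minimal CW structure $S^{k_i}=e^0\cup e^{k_i}$, with $e^0$ the base point. $\mathbb{S}(k_1,\ldots,k_n)$ has the product cell structure, whose cells are $e_J=\{(x_1,\ldots,x_n): x_i=e^0 \text{ if and only if } i\notin J\}$ for $J\subseteq[n]=\{1,\ldots,n\}$. A subcomplex is a nonempty union of such cells that is a CW subcomplex. The index of $X$ is the abstract simplicial complex $\mathcal{K}_X=\{J\subseteq[n] : e_J\text{ is a cell of }X\}$ (which contains $\emptyset$). Norm: for simplexes $J_1,\ldots,J_s\in\mathcal{K}_X$ put $$\mathrm{N}_X(J_1,\ldots,J_s)=\sum_{\ell=2}^s\Big(\Big|\bigcap_{m=1}^{\ell-1}J_m-J_\ell\Big|+|J_\ell|\Big),$$ and $\mathrm{N}^s(X)=\max\{\mathrm{N}_X(J_1,\ldots,J_s) : J_1,\ldots,J_s\in\mathcal{K}_X\}$ (repetitions among the $J_j$ are allowed). Higher topological complexity: let $J_s$ be the wedge of $s$ copies of $[0,1]$ with $0$ as base point in each, so that an element of $Y^{J_s}$ is an $s$-tuple $(f_1,\ldots,f_s)$ of paths $[0,1]\to Y$ with a common starting point. For a path connected space $Y$, $\mathrm{TC}_s(Y)$ is the smallest $m\ge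 0$ such that $Y^s$ has an open cover by $m+1$ sets on each of which $e_s:Y^{J_s}\to Y^s$, $e_s(f)=(f_1(1),\ldots,f_s(1))$, admits a continuous section. *)

(* Defs.v *)
From HB Require Import structures.
From mathcomp Require Import all_boot all_order all_algebra.
From mathcomp Require Import all_classical all_reals.
From mathcomp Require Import topology normedtype wedge_sigT.

Set Implicit Arguments.
Unset Strict Implicit.
Unset Printing Implicit Defensive.

Import Order.TTheory GRing.Theory Num.Theory.
Import numFieldNormedType.Exports.

Local Open Scope ring_scope.
Local Open Scope classical_set_scope.

Section Norm.
Variables (n s : nat).

(* 'I_s is zero-based: the index l = 2, ..., s of the usual formula is here
   l = 1, ..., s - 1. *)
Definition normJ (J : {ffun 'I_s -> {set 'I_n}}) : nat :=
  (\sum_(l < s | 0 < l)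
     (#|(\bigcap_(m < s | m < l) J m) :\: J l|%SET + #|J l|))%N.

Definition normK (K : {set {set 'I_n}}) : nat :=
  (\max_(J : {ffun 'I_s -> {set 'I_n}} | [forall i, J i \in K]) normJ J)%N.

End Norm.

Definition unit_interval (R : realType) : topologicalType :=
  set_type (`[0, 1]%classic : set R).

Lemma unit_interval0_subproof (R : realType) : (0 : R) \in `[0, 1]%classic.
Proof. by apply/mem_set; rewrite /= in_itv /= lexx ler01. Qed.

Lemma unit_interval1_subproof (R : realType) : (1 : R) \in `[0, 1]%classic.
Proof. by apply/mem_set; rewrite /= in_itv /= lexx ler01. Qed.

Definition unit_interval0 (R : realType) : unit_interval R :=
  SigSub (unit_interval0_subproof R).

Definition unit_interval1 (R : realType) : unit_interval R :=
  SigSub (unit_interval1_subproof R).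

Definition interval_wedge (R : realType) (s : nat) : topologicalType :=
  @wedge 'I_s (fun=> unit_interval R) (fun=> unit_interval0 R).

Section HigherTC.
Variables (R : realType) (s : nat) (Y : topologicalType).

(* Y^{J_s} : continuous maps only, with the compact-open topology. *)
Definition multipath : topologicalType :=
  initial_topology (id : continuousType (interval_wedge R s) Y ->
                         {compact-open, interval_wedge R s -> Y}).

Definition cartesian_power : topologicalType :=
  prod_topology (fun _ : 'I_s => Y).

Definition endpoints (f : multipath) : cartesian_power :=
  fun i => (f : continuousType (interval_wedge R s) Y)
             (@wedge_lift _ _ (fun=> unit_interval0 R) i (unit_interval1 R)).

Definition has_section_on (U : set cartesian_power) : Prop :=
  exists2 sigma : set_type U -> multipath,
    continuous sigma & forall y, endpoints (sigma y) = set_val y.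

Definition motion_planning_cover (m : nat) : Prop :=
  exists U : 'I_m.+1 -> set cartesian_power,
    [/\ forall i, open (U i),
        \bigcup_i U i = [set: cartesian_power] &
        forall i, has_section_on (U i)].

(* TC_s(Y) = m; if no cover exists, TC_s(Y) is infinite and is_TC holds for no
   natural number. *)
Definition is_TC (m : nat) : Prop :=
  motion_planning_cover m /\
  forall m', motion_planning_cover m' -> (m <= m')%N.

End HigherTC.

Definition sphere (R : realType) (k : nat) : topologicalType :=
  set_type [set x : 'rV[R]_k.+1 | \sum_(j < k.+1) x 0 j ^+ 2 = 1].

Definition sphere_product (R : realType) (n : nat) (k : 'I_n -> nat) :
    topologicalType :=
  prod_topology (fun i => sphere R (k i)).

Section Subcomplex.
(* The 0-cell of each sphere may be any of its points. *)
Variables (R : realType) (n : nat) (k : 'I_n -> nat).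
Variable e0 : forall i, sphere R (k i).

Definition cell (J : {set 'I_n}) : set (sphere_product R k) :=
  [set x | forall i, x i = e0 i <-> i \notin J].

Definition is_subcomplex (X : set (sphere_product R k)) : Prop :=
  X !=set0 /\
  exists2 F : {set {set 'I_n}},
    X = \bigcup_(J in [set` F]) cell J &
    forall J, J \in F -> closure (cell J) `<=` X.

Definition index_complex (X : set (sphere_product R k)) : {set {set 'I_n}} :=
  [set J | `[< cell J `<=` X >]]%SET.

Definition normX (s : nat) (X : set (sphere_product R k)) : nat :=
  normK s (index_complex X).

End Subcomplex.

(* Main.v *)
(* Upper bound.  For a tuple z = (z_1, ..., z_s) of points of X record which
   equalities z_l^i = z_m^i hold in each coordinate i.  With z_1^i as the common
   starting point, go to z_l^i along a short arc if the two coordinates are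
   equal, and otherwise through - z_1^i, along the half circle given by a unit
   tangent field of the odd sphere.  The arcs are run so that a coordinate
   starting at the base point does not move before time 1/2, and one ending there
   is at rest after time 1/2; hence the support of the moving point is always
   contained in that of z_1 or of z_l, and the motion stays in X.  These
   planners are continuous near each stratum of the equality pattern.  Strata
   with the same number of "first occurrences" have disjoint neighbourhoods, and
   this number is at most the norm of the supports of z, term by term.

   Lower bound.  Simplexes J_1, ..., J_s provide a product of N_X(J_1, ..., J_s)
   spheres inside X^s such that, on an open set carrying a section, each of its
   coordinates is nullhomotopic: the section joins it to a coordinate held at
   the base point.  If N open sets covered this product of N spheres, use the
   q-th nullhomotopy on the q-th set and homotopy extension: the identity would
   be homotopic to a map omitting a point.  This contradicts the
   Poincare-Miranda theorem, which is proved by evaluating the cup product of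
   coboundaries of mod 2 sign cochains on a subdivided cube. *)

Require Import Defs.
From HB Require Import structures.
From mathcomp Require Import all_boot all_order all_algebra.
From mathcomp Require Import all_classical all_reals.
From mathcomp Require Import topology normedtype wedge_sigT.
From mathcomp Require Import realfun ring lra zify.

Set Implicit Arguments.
Unset Strict Implicit.
Unset Printing Implicit Defensive.

Import Order.TTheory GRing.Theory Num.Theory.
Import numFieldNormedType.Exports.

Local Open Scope ring_scope.
Local Open Scope classical_set_scope.

(** * Cup products of coboundaries on a cubical grid *)

Section CubicalCochains.
Variables (T : finType) (p : nat).
Local Notation grid := {ffun T -> 'I_p.+2}.
Local Notation F2 := 'F_2.

Lemma addrr_F2 (x : F2) : x + x = 0.
Proof. by apply: addrr_pchar2; exact: pchar_Fp. Qed.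

Lemma addr_eq0_F2 (x y : F2) : (x + y == 0) = (x == y).
Proof. by rewrite addr_eq0; congr (_ == _); apply/eqP; rewrite eq_sym -addr_eq0 addrr_F2. Qed.

(** The terms at [(a, b)] and [(b, a)] are equal and cancel mod 2; an enumeration of [T] orders each
    pair. *)
Lemma sum_sym_F2 (A : {set T}) (X : T -> T -> F2) :
  (forall a b, X a b = X b a) -> \sum_(a in A) \sum_(b in A :\ a) X a b = 0.
Proof.
move=> Xsym.
pose lt (a b : T) := (enum_rank a < enum_rank b)%N.
have E a : a \in A -> \sum_(b in A :\ a) X a b =
    \sum_(b in A | lt a b) X a b + \sum_(b in A | lt b a) X a b.
  move=> _; rewrite (bigID (lt a)) /=; congr (_ + _); apply: eq_bigl => b;
    rewrite !inE /lt -?leqNgt.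
    case: (eqVneq b a) => [->|_] /=; first by rewrite ltnn andbF.
    by [].
  case: (eqVneq b a) => [->|ba] /=; first by rewrite ltnn andbF.
  by rewrite leq_eqVlt (inj_eq val_inj) (inj_eq enum_rank_inj) (negbTE ba).
rewrite (eq_bigr _ E) big_split /=.
rewrite [X in _ + X](exchange_big_dep (mem A)) //=; last by move=> ? ? ? /andP[].
rewrite -[RHS](addrr_F2 (\sum_(i in A) \sum_(b in A | lt i b) X i b)).
congr (_ + _); apply: eq_bigr => a aA; apply: eq_big => b.
  by rewrite aA /=.
by move=> _; exact: Xsym.
Qed.

(** The cyclic successor makes a step a bijection of the grid, so sums can be reindexed along it;
    inside a cube of the grid it never wraps around. *)
Definition step (w : grid) (a : T) : grid :=
  [ffun b => if b == a then ordS (w b) else w b].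

Lemma stepC w a b : step (step w a) b = step (step w b) a.
Proof. by apply/ffunP => c; rewrite !ffunE; case: eqP; case: eqP. Qed.

(* Serre's cubical cup product of the coboundaries of the 0-cochains [fs],
   evaluated on the cube with least vertex [w] and directions [A]. *)
Fixpoint cupd (fs : seq (grid -> F2)) (A : {set T}) (w : grid) : F2 :=
  if fs is f :: fs' then
    \sum_(a in A) (f (step w a) + f w) * cupd fs' (A :\ a) (step w a)
  else 1.

Lemma setD1C (A : {set T}) a b : A :\ a :\ b = A :\ b :\ a.
Proof. by apply/setP => c; rewrite !inE andbCA. Qed.

(** Mod 2 cocycle identity: far and near facets contribute equally. After one factor is expanded,
    the terms at the opposite corner of a 2-face are symmetric in its directions; the rest is the
    induction hypothesis at [step w a] and at [w]. *)
Lemma cupd_closed fs (A : {set T}) (w : grid) :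
  \sum_(a in A) cupd fs (A :\ a) (step w a) = \sum_(a in A) cupd fs (A :\ a) w.
Proof.
elim: fs A w => [|f fs IH] A w //=.
pose c (a b : T) v := cupd fs (A :\ a :\ b) v.
have cC a b v : c a b v = c b a v by rewrite /c setD1C.
apply/eqP; rewrite -addr_eq0_F2 -big_split /=; apply/eqP.
transitivity (\sum_(a in A) \sum_(b in A :\ a)
   (f (step (step w a) b) * c a b (step (step w a) b) +
    (f (step w a) * c a b (step (step w a) b) + f (step w b) * c a b (step w b))
    + f w * c a b (step w b))).
  apply: eq_bigr => a _; rewrite -big_split /=; apply: eq_bigr => b _.
  by rewrite /c !mulrDl !addrA.
under eq_bigr do rewrite !big_split /=.
rewrite !big_split /= sum_sym_F2; last by move=> a b; rewrite stepC cC.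
rewrite add0r.
have swap (X : T -> T -> F2) : \sum_(a in A) \sum_(b in A :\ a) X a b =
    \sum_(a in A) \sum_(b in A :\ a) X b a.
  rewrite (exchange_big_dep (mem A)) /=; last by move=> a b _ /setD1P[].
  apply: eq_bigr => a aA; apply: eq_bigl => b; rewrite !inE aA eq_sym andbT.
  by rewrite andbC.
rewrite [X in _ + X + _]swap -big_split /= big1 ?add0r => [|a _].
  under eq_bigr do rewrite -big_distrr /= IH big_distrr /=.
  by apply: sum_sym_F2 => a b; rewrite setD1C.
under [X in _ + X]eq_bigr do rewrite cC.
by rewrite -!big_distrr /= -mulrDr IH addrr_F2 mulr0.
Qed.

(** Leibniz rule: the product of the remaining coboundaries is closed, so the whole product is the
    coboundary of [f] times it. In this form sums over the grid telescope. *)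
Lemma cupd_coboundary f fs (A : {set T}) (w : grid) : cupd (f :: fs) A w =
  \sum_(a in A) (f (step w a) * cupd fs (A :\ a) (step w a) +
                 f w * cupd fs (A :\ a) w).
Proof.
rewrite big_split /= -[X in _ + X]big_distrr /= -cupd_closed big_distrr -big_split.
by apply: eq_bigr => a _; rewrite mulrDl.
Qed.

(** Least vertices of the small cubes with directions [A] that tile the face of the grid on which
    all other coordinates are maximal. *)
Definition face (A : {set T}) (w : grid) := [forall t, (t \in A) == (w t != ord_max)].

(** Stokes in the direction [a]: every inner layer occurs twice and cancels mod 2, so only the two
    end layers survive. *)
Lemma sum_step_face (A : {set T}) a (g : grid -> F2) : a \in A ->
  \sum_(w : grid | face A w) (g (step w a) + g w) =
  \sum_(w : grid | face (A :\ a) w) g w +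
  \sum_(w : grid | [forall t, if t == a then w t == ord0 else (t \in A) == (w t != ord_max)]) g w.
Proof.
move=> aA; rewrite big_split /=.
pose P (w : grid) := [forall t, (t == a) || ((t \in A) == (w t != ord_max))].
have faceE w : face A w = P w && (w a != ord_max).
  apply/forallP/andP => [H|[/forallP H wa] t].
    split; last by move: (H a); rewrite aA => /eqP <-.
    by apply/forallP => t; rewrite H orbT.
  by move: (H t); case: eqVneq => //= -> _; rewrite aA wa.
have faceaE w : face (A :\ a) w = P w && (w a == ord_max).
  apply/forallP/andP => [H|[/forallP H wa] t].
    split; last by move: (H a); rewrite !inE eqxx; case: (w a == _).
    apply/forallP => t; move: (H t); rewrite !inE.
    by case: (t =P a) => //= _ ->.
  rewrite !inE; move: (H t); case: eqVneq => //= -> _.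
  by rewrite wa.
rewrite [X in X + _ = _](_ : _ = \sum_(w : grid | P w && (w a != ord0)) g w).
  rewrite (eq_bigl _ _ faceaE).
  rewrite [X in _ = _ + X](_ : _ = \sum_(w : grid | P w && (w a == ord0)) g w); last first.
    apply: eq_bigl => w; apply/forallP/andP => [H|[/forallP H wa] t].
      split; last by move: (H a); rewrite eqxx.
      by apply/forallP => t; move: (H t); case: eqVneq.
    by move: (H t); case: eqVneq => //= ->.
  rewrite (eq_bigl _ _ faceE).
  pose r := \sum_(w : grid | P w && (w a != ord0) && (w a != ord_max)) g w.
  have -> : \sum_(w : grid | P w && (w a != ord0)) g w =
      r + \sum_(w : grid | P w && (w a == ord_max)) g w.
    rewrite (bigID (fun w : grid => w a == ord_max)) /= addrC; congr (_ + _).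
    by apply: eq_bigl => w; case: (w a =P ord_max) => [->|]; rewrite ?andbF ?andbT.
  have -> : \sum_(w : grid | P w && (w a != ord_max)) g w =
      r + \sum_(w : grid | P w && (w a == ord0)) g w.
    rewrite (bigID (fun w : grid => w a == ord0)) /= addrC; congr (_ + _).
      by apply: eq_bigl => w; rewrite andbAC.
    by apply: eq_bigl => w; case: (w a =P ord0) => [->|]; rewrite ?andbF ?andbT.
  by rewrite addrACA addrr_F2 add0r.
pose unstep (w : grid) : grid := [ffun b => if b == a then ord_pred (w b) else w b].
have shK : cancel (step^~ a) unstep.
  by move=> w; apply/ffunP => b; rewrite !ffunE; case: eqP => // _; exact: ordSK.
have unK : cancel unstep (step^~ a).
  by move=> w; apply/ffunP => b; rewrite !ffunE; case: eqP => // _; exact: ord_predK.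
rewrite [RHS](reindex (step^~ a)) /=; last by exists unstep => w _.
apply: eq_bigl => w; rewrite faceE; congr (_ && _).
  apply: eq_forallb => t; rewrite ffunE; by case: eqVneq.
rewrite ffunE eqxx -(inj_eq val_inj) -[in RHS](inj_eq val_inj) /=; congr (~~ _).
case: (w a) => k /= kp; rewrite ltnS leq_eqVlt in kp.
case/orP: kp => [/eqP ->|kp]; first by rewrite modnn !eqxx.
by rewrite modn_small ?ltnS // (ltn_eqF kp).
Qed.

Variable f : T -> grid -> F2.
Hypothesis f0 : forall t (w : grid), w t = ord0 -> f t w = 0.
Hypothesis f1 : forall t (w : grid), w t = ord_max -> f t w = 1.

(** Such a cube lies in an end layer normal to [a], where [f a] is constant; the coboundary of [f a]
    is therefore a zero factor. *)
Lemma cupd_vanish (ts : seq T) a (B : {set T}) (w : grid) : a \in ts -> a \notin B ->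
  (w a = ord0) \/ (w a = ord_max) -> cupd [seq f t | t <- ts] B w = 0.
Proof.
elim: ts B w => // t ts IH B w ats aB wa.
rewrite /=; apply: big1 => b bB.
have ab : (a == b) = false by apply: contraNF aB => /eqP ->.
have sa : step w b a = w a by rewrite ffunE ab.
have [E|at_] := eqVneq t a.
  suff -> : f t (step w b) = f t w by rewrite addrr_F2 mul0r.
  by rewrite E; case: wa => wa; [rewrite !f0 ?sa|rewrite !f1 ?sa].
rewrite IH ?mulr0 ?sa //.
  by move: ats; rewrite inE eq_sym (negbTE at_).
by rewrite !inE (negbTE aB) andbF.
Qed.

(** Stokes for the first factor: facets normal to other directions vanish by [cupd_vanish], the one
    at [w t = ord0] vanishes by [f0], and at [ord_max] the factor is 1, which leaves the same sum in
    one dimension less. *)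
Lemma sum_cupd (ts : seq T) : uniq ts ->
  \sum_(w : grid | face [set t in ts] w) cupd [seq f t | t <- ts] [set t in ts] w = 1.
Proof.
elim: ts => [_|t ts IH /= /andP[tts uts]].
  rewrite (bigD1 [ffun=> ord_max]) /=; last first.
    by apply/forallP => t; rewrite inE ffunE eqxx.
  rewrite big1 ?addr0 // => w /andP[/forallP H] /eqP[]; apply/ffunP => t.
  by rewrite ffunE; move: (H t); rewrite inE eq_sym eqbF_neg negbK => /eqP.
set A := finset (mem (t :: ts)).
have tA : t \in A by rewrite !inE eqxx.
have At : A :\ t = finset (mem ts).
  apply/setP => a; rewrite !inE; case: eqVneq => //= ->.
  by rewrite (negbTE tts).
under eq_bigr do rewrite -[\sum_(_ in _) _]/(cupd (f t :: map f ts) A _) cupd_coboundary.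
rewrite exchange_big /= (bigD1 t) //= [X in _ + X]big1 ?addr0 => [|a /andP[aA at_]].
  rewrite (sum_step_face (fun w : grid => f t w * cupd (map f ts) (A :\ t) w)) //.
  rewrite [X in _ + X]big1 ?addr0 => [|w /forallP/(_ t)]; last first.
    by rewrite eqxx => /eqP w0; rewrite f0 ?mul0r.
  rewrite At -{}IH //; apply: eq_bigr => w /forallP/(_ t).
  by rewrite -At setD11 eq_sym eqbF_neg negbK => /eqP wt; rewrite f1 ?mul1r.
have ats : a \in ts by move: aA; rewrite !inE (negbTE at_).
rewrite (sum_step_face (fun w : grid => f t w * cupd (map f ts) (A :\ a) w)) //.
rewrite !big1 ?addr0 // => w /forallP/(_ a).
  by rewrite eqxx => /eqP wa; rewrite (@cupd_vanish _ a) ?mulr0 ?setD11 //; left.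
rewrite setD11 eq_sym eqbF_neg negbK => /eqP wa.
by rewrite (@cupd_vanish _ a) ?mulr0 ?setD11 //; right.
Qed.

(** A nonzero summand is a path along edges of the cube on which each [f t] changes along its own
    edge. *)
Lemma cupd_neq0 (ts : seq T) (A : {set T}) (w : grid) :
    (forall t, t \in A -> w t != ord_max) ->
    cupd [seq f t | t <- ts] A w != 0 ->
  forall t, t \in ts -> exists u u' : grid,
    [/\ forall b, (w b <= u b <= w b + (b \in A))%N,
        forall b, (w b <= u' b <= w b + (b \in A))%N & f t u != f t u'].
Proof.
elim: ts A w => // t ts IH A w wA /= nz.
have [a aA] : exists2 a, a \in A &
    (f t (step w a) + f t w) * cupd (map f ts) (A :\ a) (step w a) != 0.
  apply/exists_inP; apply: contraNT nz => /exists_inPn H.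
  by apply/eqP/big1 => a /H /negPn/eqP.
rewrite mulf_eq0 negb_or addr_eq0_F2 => /andP[fa nza].
have sa b : step w a b = (w b + (b == a))%N :> nat.
  rewrite ffunE; case: eqVneq => [->|_]; last by rewrite addn0.
  move: (wA a aA); rewrite -(inj_eq val_inj) /= => wa.
  by rewrite modn_small ?addn1 // ltnS ltn_neqAle wa -ltnS ltn_ord.
move=> t'; rewrite inE => /predU1P[->|t'ts].
  exists (step w a), w; split => // b; last by rewrite leqnn leq_addr.
  rewrite sa leq_addr leq_add2l; case: eqVneq => [->|//]; by rewrite aA.
have [|u [u' [Hu Hu' fuu']]] := IH _ _ _ nza t' t'ts.
  by move=> b; rewrite !inE => /andP[ba bA]; rewrite ffunE (negbTE ba) wA.
exists u, u'; split => // b.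
  move: (Hu b); rewrite sa !inE; case: eqVneq => [->|_]; rewrite ?aA ?addn0 /=; lia.
move: (Hu' b); rewrite sa !inE; case: eqVneq => [->|_]; rewrite ?aA ?addn0 /=; lia.
Qed.

Lemma exists_sign_change_cube : exists w : grid, forall t, exists u u' : grid,
  [/\ forall b, (w b <= u b <= (w b).+1)%N,
      forall b, (w b <= u' b <= (w b).+1)%N & f t u != f t u'].
Proof.
have := sum_cupd (enum_uniq T).
set A := finset _ => S1.
have [w /forallP wA nz] : exists2 w, face A w & cupd [seq f t | t <- enum T] A w != 0.
  apply/exists_inP; apply: contra_eqT S1 => /exists_inPn H.
  by rewrite big1 1?eq_sym ?oner_neq0 // => w /H /negPn/eqP.
exists w => t.
have [|u [u' [Hu Hu' fu]]] := @cupd_neq0 _ A w _ nz t (mem_enum T t).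
  by move=> b bA; rewrite -(eqP (wA b)).
exists u, u'; split => // b.
  by move: (Hu b) (leq_b1 (b \in A)); lia.
by move: (Hu' b) (leq_b1 (b \in A)); lia.
Qed.

End CubicalCochains.

(** * The Poincare-Miranda theorem *)

(** Without a common zero, compactness gives a mesh so fine that around every point of the cube some
    [F t] has constant sign; this contradicts the small cube on which all sign labels change. *)
Lemma poincare_miranda (R : realType) n (F : 'I_n -> 'rV[R]_n -> R) (a b : R) :
  a < b -> (forall t, continuous (F t)) ->
  (forall t (x : 'rV[R]_n), x 0 t = a -> F t x <= 0) ->
  (forall t (x : 'rV[R]_n), x 0 t = b -> 0 <= F t x) ->
  exists x, forall t, F t x = 0.
Proof.
move=> ab Fc Fa Fb; apply: contrapT => /forallNP nz.
pose K := [set v : 'rV[R]_n | forall i, `[a, b]%classic (v ord0 i)].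
have cK : compact K by apply: (@rV_compact R n (fun=> `[a, b]%classic)) => i; exact: segment_compact.
pose good (p : nat) (x : 'rV[R]_n) := exists t,
  (forall u : 'rV[R]_n, (forall j, `|u 0 j - x 0 j| <= (b - a) / p.+1%:R) -> 0 < F t u) \/
  (forall u : 'rV[R]_n, (forall j, `|u 0 j - x 0 j| <= (b - a) / p.+1%:R) -> F t u < 0).
have ba0 : 0 < b - a by rewrite subr_gt0.
have : \forall p \near \oo, K `<=` good p.
  move/compact_near_coveringP : cK; apply => x _.
  have /existsNP [t /eqP Ftx] := nz x.
  have small (e : R) : 0 < e -> \forall p \near \oo, (b - a) / p.+1%:R < e.
    move=> e0; near=> p; rewrite ltr_pdivrMr // mulrC -ltr_pdivrMr //.
    apply: lt_le_trans (_ : p%:R <= _); last by rewrite ler_nat.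
    by near: p; exact: nbhs_infty_gtr.
  have ext (S : set 'rV[R]_n) : nbhs x S -> \forall y \near (x : 'rV[R]_n) & p \near \oo,
      forall u : 'rV[R]_n, (forall j, `|u 0 j - (y : 'rV[R]_n) 0 j| <= (b - a) / p.+1%:R) -> S u.
    move=> /nbhs_ballP[e /= e0 eS].
    have e20 : 0 < e / 2 by rewrite divr_gt0.
    exists (ball x (e / 2), [set p : nat | (b - a) / p.+1%:R < e / 2]).
      by split => /=; [exact: nbhsx_ballx|exact: small].
    move=> [y p] /= [[_ xy] pe] u uy; apply: eS; split => // i j.
    rewrite /ball /= ord1.
    have := xy 0 j; rewrite /ball /= => xyj.
    rewrite (splitr e) (le_lt_trans (ler_distD (y 0 j) _ _))// ltrD//.
    by rewrite distrC (le_lt_trans (uy j)).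
  case: (ltrgtP (F t x) 0) Ftx => // Ft0 _.
    have /ext : nbhs x [set u | F t u < 0] by exact: (cvgr_lt (F t x) (Fc t x) 0 Ft0).
    by apply: filterS => -[y p] /= H; exists t; right.
  have /ext : nbhs x [set u | 0 < F t u] by exact: (cvgr_gt (F t x) (Fc t x) 0 Ft0).
  by apply: filterS => -[y p] /= H; exists t; left.
case=> p _ /(_ p (leqnn p)) Kgood.
pose pt (w : {ffun 'I_n -> 'I_p.+2}) : 'rV[R]_n :=
  \row_j (a + (b - a) * (w j)%:R / p.+1%:R).
(* The label is forced on the two faces normal to [t]. By [Fa] and [Fb] it still agrees with the
   sign of [F t] wherever that is nonzero. *)
pose f t (w : {ffun 'I_n -> 'I_p.+2}) : 'F_2 :=
  ((w t == ord_max) || (w t != ord0) && (0 < F t (pt w)))%:R.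
have p0 : p.+1%:R != 0 :> R by rewrite pnatr_eq0.
have ptmax t (w : {ffun 'I_n -> 'I_p.+2}) : w t = ord_max -> pt w 0 t = b.
  by move=> wt; rewrite mxE wt /= mulfK // addrC subrK.
have pt0 t (w : {ffun 'I_n -> 'I_p.+2}) : w t = ord0 -> pt w 0 t = a.
  by move=> wt; rewrite mxE wt /= mulr0 mul0r addr0.
have [||w Hw] := @exists_sign_change_cube _ p f.
- by move=> t w wt; rewrite /f wt.
- by move=> t w wt; rewrite /f wt eqxx.
have [|t Ht] := Kgood (pt w).
  move=> j; rewrite /= in_itv /= mxE lerDl divr_ge0 ?mulr_ge0 ?(ltW ba0) //=.
  rewrite -lerBrDl -mulrA ler_piMr ?(ltW ba0)// ler_pdivrMr // mul1r ler_nat.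
  by rewrite -ltnS ltn_ord.
have close (u : {ffun 'I_n -> 'I_p.+2}) : (forall j, (w j <= u j <= (w j).+1)%N) ->
    forall j, `|pt u 0 j - pt w 0 j| <= (b - a) / p.+1%:R.
  move=> Hu j; rewrite !mxE opprD addrACA subrr add0r -mulrBl -mulrBr.
  rewrite normrM [`|_^-1|]ger0_norm ?invr_ge0 // ler_pM2r ?invr_gt0 //.
  rewrite normrM gtr0_norm // ler_piMr ?(ltW ba0) //.
  have /andP[uj1 uj2] := Hu j.
  by rewrite -natrB // ger0_norm // lern1 leq_subLR addn1.
have ftP u : (0 < F t (pt u) -> f t u = 1) /\ (F t (pt u) < 0 -> f t u = 0).
  rewrite /f; split => [F0|F0].
    case: (eqVneq (u t) ord_max) => // _.
    case: (eqVneq (u t) ord0) => [/pt0/Fa|]; first by rewrite leNgt F0.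
    by rewrite F0 orbT.
  case: (eqVneq (u t) ord_max) => [/ptmax/Fb|]; first by rewrite leNgt F0.
  by rewrite (ltNge 0) (ltW F0) andbF.
have [u [u' [Hu Hu']]] := Hw t.
have [u0 u1] := ftP u; have [u'0 u'1] := ftP u'.
case: Ht => Ht.
  by rewrite u0 ?u'0 ?eqxx //; apply: Ht; exact: close.
by rewrite u1 ?u'1 ?eqxx //; apply: Ht; exact: close.
Unshelve. all: by end_near. Qed.

(** * Convergence and normalization *)

Lemma cvg_initial (S : choiceType) (X : topologicalType) (f : S -> X)
    (F : set_system S) {FF : Filter F} (a : S) :
  f @ F --> f a -> F --> (a : initial_topology f).
Proof.
move=> fF U [_ [[B oB <-] Ba] /= BU].
apply: (filterS BU); apply: fF.
by apply: open_nbhs_nbhs; split.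
Qed.

Lemma cvg_set_type (X : topologicalType) (A : set X) Z (F : set_system Z)
    {FF : Filter F} (f : Z -> set_type A) (a : set_type A) :
  (set_val \o f) @ F --> (set_val a : X) -> f @ F --> a.
Proof. exact: cvg_initial. Qed.

Lemma cvg_prod_topology I (X : I -> topologicalType) Z (F : set_system Z)
    {FF : Filter F} (f : Z -> prod_topology X) (a : prod_topology X) :
  (forall i, (fun z => f z i) @ F --> a i) -> f @ F --> a.
Proof.
by move=> H; apply/cvg_sup => i; apply: cvg_initial; exact: H.
Qed.

Lemma set_val_continuous (X : topologicalType) (A : set X) :
  continuous (set_val : set_type A -> X).
Proof. exact: initial_continuous. Qed.

Lemma prod_coord_continuous (I : choiceType) (X : I -> topologicalType) i :
  continuous (fun x : prod_topology X => x i).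
Proof. exact: proj_continuous. Qed.

Section CvgReal.
Context (R : realType) (Z : Type) (F : set_system Z) {FF : Filter F}.

Lemma cvg_maxr (f g : Z -> R) (a b : R) : f @ F --> a -> g @ F --> b ->
  Num.max (f x) (g x) @[x --> F] --> Num.max a b.
Proof.
move=> fa gb; rewrite maxr_absE; under eq_fun do rewrite maxr_absE.
apply: cvgM; last exact: cvg_cst.
by apply: cvgD; [exact: cvgD|apply: cvg_norm; exact: cvgB].
Qed.

Lemma cvg_bigsum (I : Type) (r : seq I) (f : I -> Z -> R) (a : I -> R) :
  (forall i, f i @ F --> a i) ->
  \sum_(i <- r) f i x @[x --> F] --> \sum_(i <- r) a i.
Proof.
move=> fa; elim: r => [|i r IH].
  by rewrite big_nil; under eq_fun do rewrite big_nil; exact: cvg_cst.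
by rewrite big_cons; under eq_fun do rewrite big_cons; exact: cvgD.
Qed.

Lemma cvg_bigprod (I : Type) (r : seq I) (f : I -> Z -> R) (a : I -> R) :
  (forall i, f i @ F --> a i) ->
  \prod_(i <- r) f i x @[x --> F] --> \prod_(i <- r) a i.
Proof.
move=> fa; elim: r => [|i r IH].
  by rewrite big_nil; under eq_fun do rewrite big_nil; exact: cvg_cst.
by rewrite big_cons; under eq_fun do rewrite big_cons; exact: cvgM.
Qed.

Lemma cvg_sqrr (f : Z -> R) (a : R) : f @ F --> a -> f x ^+ 2 @[x --> F] --> a ^+ 2.
Proof. by move=> fa; rewrite expr2; under eq_fun do rewrite expr2; exact: cvgM. Qed.

Lemma cvg_sqrtr (f : Z -> R) (a : R) : f @ F --> a ->
  Num.sqrt (f x) @[x --> F] --> Num.sqrt a.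
Proof. by apply: continuous_cvg; exact: sqrt_continuous. Qed.

Lemma cvg_invr (f : Z -> R) (a : R) : a != 0 -> f @ F --> a ->
  (f x)^-1 @[x --> F] --> a^-1.
Proof. exact: cvgV. Qed.

Lemma cvg_row n (f : Z -> 'rV[R]_n) (a : 'rV[R]_n) :
  (forall j, f x 0 j @[x --> F] --> a 0 j) -> f @ F --> a.
Proof.
move=> H U /nbhs_ballP[e /= e0 eU].
have : \forall x \near F, forall j, `|a 0 j - f x 0 j| < e.
  by apply: filter_forall => j; move/cvgrPdist_lt : (H j); apply.
by apply: filterS => x xe; apply: eU; split => // i j; rewrite ord1; exact: xe.
Qed.

End CvgReal.

Lemma cvg_prodT (X Y : topologicalType) Z (F : set_system Z) {FF : Filter F}
    (f : Z -> X) (g : Z -> Y) (a : X) (b : Y) : f @ F --> a -> g @ F --> b ->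
  (f z, g z) @[z --> F] --> ((a, b) : X * Y).
Proof. by move=> fa gb; exact: cvg_pair. Qed.

Lemma cvg_for (X Y : topologicalType) (h : X -> Y) Z (F : set_system Z) (f : Z -> X)
    (a : X) : {for a, continuous h} -> f @ F --> a -> h (f z) @[z --> F] --> h a.
Proof. by move=> ha fa; exact: (cvg_comp f h fa). Qed.
Arguments cvg_for {X Y h Z F} f {a}.

(** Lebesgue number argument: for some entourage [E] each [E]-neighbourhood lies in some [V q], and
    a Urysohn function separates the centres belonging to [q] from the complement of [V q]. *)
Lemma shrink_cover (R : realType) (P : uniformType) (I : Type)
    (z0 : P) (V : I -> set P) : compact [set: P] -> (forall q, open (V q)) ->
  (forall z, exists q, V q z) ->
  exists lam : I -> P -> R, [/\ forall q, continuous (lam q),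
    forall z, exists q, lam q z = 1 &
    forall q z, ~ V q z -> \forall z' \near z, lam q z' = 0].
Proof.
move=> /compact_near_coveringP cP oV covV.
have [E entE HE] : exists2 E : set (P * P), entourage E &
    forall x, exists q, forall y, E (x, y) -> V q y.
  have PE : ProperFilter (@entourage P).
    apply: Build_ProperFilter_ex.
    by move=> A entA; exists (z0, z0); exact: entourage_refl.
  have H : \forall E \near powerset_filter_from (@entourage P),
      [set: P] `<=` (fun x => exists q, forall y, E (x, y) -> V q y).
    apply: cP => x _.
    have [q Vqx] := covV x.
    have /nbhsP[E0 entE0 E0V] : nbhs x (V q) by apply: open_nbhs_nbhs; split.
    have [E1 entE1 E1E0] := entourage_split_ex entE0.
    exists (xsection E1 x, [set E | E `<=` E1]).
      by split => /=; [apply/nbhsP; exists E1|exact: small_set_sub].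
    move=> [x' E] /= [/xsectionP xx' EE1]; exists q => y Exy.
    by apply/E0V/xsectionP/E1E0; exists x' => //; exact: EE1.
  near (powerset_filter_from (@entourage P)) => E.
  exists E; first by near: E; exact: near_small_set.
  by move=> x; have := near H E; apply.
have sep q : uniform_separator [set x | forall y, E (x, y) -> V q y] (~` V q).
  apply: uniform_separatorW; exists E => //.
  by rewrite -subset0 => -[x y] /= [[xE nVy] /xE].
pose u q := Urysohn (R := R) [set x | forall y, E (x, y) -> V q y] (~` V q).
(* The factor 2 makes the function vanish wherever [u q] exceeds 1/2, hence on a whole neighbourhood
   of the complement of [V q]. *)
exists (fun q z => Num.max 0 (1 - 2 * u q z)); split.
- move=> q z; apply: cvg_maxr; first exact: cvg_cst.
  apply: cvgB; first exact: cvg_cst.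
  by apply: cvgM; [exact: cvg_cst|exact: Urysohn_continuous].
- move=> z; have [q Hq] := HE z; exists q.
  have -> : u q z = 0 by apply: (Urysohn_sub0 (sep q)); exists z.
  by rewrite mulr0 subr0; apply/max_idPr.
- move=> q z nV.
  have uz1 : u q z = 1 by apply: (Urysohn_sub1 (sep q)); exists z.
  have : \forall z' \near z, 1/2 < u q z'.
    apply: (cvgr_gt (u q z) (@Urysohn_continuous _ _ _ _ z)).
    by rewrite uz1; lra.
  by apply: filterS => z' uz'; apply/max_idPl; lra.
Unshelve. all: by end_near. Qed.

Lemma compact_set_type (X : topologicalType) (A : set X) :
  compact A -> compact [set: set_type A].
Proof.
move=> cA G PG _.
have GA : (set_val @ G) A.
  by apply: (@filterS _ G _ setT) => [z _|]; [exact: (set_valP z)|exact: filterT].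
have [p [Ap clp]] := cA (set_val @ G) _ GA.
exists (SigSub (mem_set Ap)); split => // B C GB [_ [[D oD <-] Dp] DC].
have /= [z [[b Bb <-] Db]] : (set_val @` B) `&` D !=set0.
  apply: clp; last by apply: open_nbhs_nbhs; split.
  by apply: (@filterS _ G _ B) => // b Bb; exists b.
by exists b; split => //; exact: DC.
Qed.

(** * Unit spheres and radial projection *)

Section Spheres.
Variable R : realType.
Implicit Types k : nat.

(** The Euclidean norm squared; the norm that row vectors carry is the maximum norm. *)
Definition sqn k (v : 'rV[R]_k) : R := \sum_j v 0 j ^+ 2.

Lemma sqn_ge0 k (v : 'rV[R]_k) : 0 <= sqn v.
Proof. by apply: sumr_ge0 => j _; exact: sqr_ge0. Qed.

Lemma sqn_eq0 k (v : 'rV[R]_k) : (sqn v == 0) = (v == 0).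
Proof.
apply/eqP/eqP => [H|->]; last by apply: big1 => j _; rewrite mxE expr0n.
apply/rowP => j; rewrite mxE; apply/eqP; rewrite -sqrf_eq0; apply/eqP.
by apply: (psumr_eq0P _ H) => // i _; exact: sqr_ge0.
Qed.

Lemma sqnZ k (a : R) (v : 'rV[R]_k) : sqn (a *: v) = a ^+ 2 * sqn v.
Proof. by rewrite mulr_sumr; apply: eq_bigr => j _; rewrite mxE exprMn. Qed.

Lemma cvg_coord k Z (F : set_system Z) {FF : Filter F} (f : Z -> 'rV[R]_k)
    (a : 'rV[R]_k) j : f @ F --> a -> f x 0 j @[x --> F] --> a 0 j.
Proof.
move=> fa; apply: (cvg_comp f (fun v : 'rV[R]_k => v 0 j) fa).
exact: (@coord_continuous R 1 k 0 j a).
Qed.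

Lemma cvg_sqn k Z (F : set_system Z) {FF : Filter F} (f : Z -> 'rV[R]_k)
    (a : 'rV[R]_k) : f @ F --> a -> sqn (f x) @[x --> F] --> sqn a.
Proof.
by move=> fa; apply: cvg_bigsum => j; apply: cvg_sqrr; exact: cvg_coord.
Qed.

Lemma sqn_sphere k (x : sphere R k) : sqn (set_val x) = 1.
Proof. exact: (set_valP x). Qed.

(** The default value [e] is taken only at [v = 0]. *)
Definition normalize k (e : sphere R k) (v : 'rV[R]_k.+1) : sphere R k :=
  insubd e ((Num.sqrt (sqn v))^-1 *: v).

Lemma set_val_normalize k (e : sphere R k) (v : 'rV[R]_k.+1) : v != 0 ->
  set_val (normalize e v) = (Num.sqrt (sqn v))^-1 *: v.
Proof.
move=> v0; rewrite [LHS]val_insubd ifT //; apply/mem_set.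
rewrite /= -/(sqn _) sqnZ exprVn sqr_sqrtr ?sqn_ge0 // mulVf //.
by rewrite sqn_eq0.
Qed.

Lemma normalize_sphere k (e x : sphere R k) (c : R) : 0 < c ->
  normalize e (c *: set_val x) = x.
Proof.
move=> c0; apply: val_inj => /=.
have nz : c *: set_val x != 0.
  by rewrite -sqn_eq0 sqnZ sqn_sphere mulr1 sqrf_eq0 gt_eqF.
rewrite -[LHS]/(set_val _) set_val_normalize // sqnZ sqn_sphere mulr1.
by rewrite sqrtr_sqr gtr0_norm // scalerA mulVf ?gt_eqF // scale1r.
Qed.

Lemma cvg_normalize k (e : sphere R k) Z (F : set_system Z)
    {FF : Filter F} (f : Z -> 'rV[R]_k.+1) (a : 'rV[R]_k.+1) : a != 0 ->
  f @ F --> a -> normalize e (f x) @[x --> F] --> normalize e a.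
Proof.
move=> a0 fa; apply: cvg_set_type.
rewrite set_val_normalize //.
have sa0 : sqn a != 0 by rewrite sqn_eq0.
have /= fn0 : \forall x \near F, f x != 0.
  have : \forall x \near F, 0 < sqn (f x).
    by apply: (cvgr_gt (sqn a)); [exact: cvg_sqn|rewrite lt_def sa0 sqn_ge0].
  by apply: filterS => x; rewrite -sqn_eq0 => /gt_eqF ->.
apply: (@cvg_trans _ ((fun x => (Num.sqrt (sqn (f x)))^-1 *: f x) @ F)).
  apply: near_eq_cvg; apply: filterS fn0 => x fx0.
  by rewrite /= set_val_normalize.
apply: cvg_row => j; rewrite mxE; under eq_fun do rewrite mxE.
apply: cvgM; last exact: cvg_coord.
apply: cvg_invr; first by rewrite sqrtr_eq0 -ltNge lt_def sa0 sqn_ge0.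
by apply: cvg_sqrtr; exact: cvg_sqn.
Qed.

Lemma sphere_coord_itv k (x : sphere R k) j : -1 <= set_val x 0 j <= 1.
Proof.
have H : set_val x 0 j ^+ 2 <= 1.
  apply: (@le_trans _ _ (sqn (set_val x))); last by rewrite sqn_sphere.
  rewrite /sqn (bigD1 j) //= lerDl.
  by apply: sumr_ge0 => i _; exact: sqr_ge0.
by apply/andP; split; nra.
Qed.

Lemma sphere_compact k : compact [set: sphere R k].
Proof.
apply: compact_set_type; apply: (@subclosed_compact _ _
    [set v : 'rV[R]_k.+1 | forall i, `[-1, 1]%classic (v ord0 i)]).
- rewrite (_ : mkset _ = (@sqn k.+1) @^-1` [set 1]) //.
  apply: closed_comp; last exact: closed_eq.
  by move=> v _; apply: (@cvg_sqn k.+1 _ (nbhs v) _ id v); exact: cvg_id.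
- by apply: (@rV_compact R k.+1 (fun=> `[-1, 1]%classic)) => i; exact: segment_compact.
- move=> v /= v1 j; rewrite /= in_itv.
  exact: (sphere_coord_itv (SigSub (mem_set v1)) j).
Qed.

End Spheres.

(** * The category of a product of spheres *)

Section Category.
Variables (R : realType) (I : finType) (d : I -> nat).
Local Notation P := (prod_topology (fun q => sphere R (d q))).

Lemma sphere_prod_compact : compact [set: P].
Proof.
rewrite (_ : [set: P] = [set f : P | forall i, [set: sphere R (d i)] (f i)]).
  apply: (@tychonoff I (fun q => sphere R (d q)) (fun=> setT)) => i.
  exact: sphere_compact.
by apply/seteqP; split.
Qed.

Lemma sphere_prod_shrink (z0 : P) (J : Type) (V : J -> set P) :
  (forall q, open (V q)) -> (forall z, exists q, V q z) ->
  exists lam : J -> P -> R, [/\ forall q, continuous (lam q),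
    forall z, exists q, lam q z = 1 &
    forall q z, ~ V q z -> \forall z' \near z, lam q z' = 0].
Proof.
pose U q : uniformType := set_type [set x : 'rV[R]_(d q).+1 | \sum_(j < (d q).+1) x 0 j ^+ 2 = 1].
exact: (@shrink_cover R (prod_topology U) J z0 V sphere_prod_compact).
Qed.

Variables (V : I -> set P) (h : forall q, P * R -> sphere R (d q)).
Variable c : forall q, sphere R (d q).
Hypothesis oV : forall q, open (V q).
Hypothesis covV : forall z, exists q, V q z.
Hypothesis h0 : forall q z, V q z -> h q (z, 0) = z q.
Hypothesis h1 : forall q z, V q z -> h q (z, 1) = c q.
Hypothesis hc : forall q z t, V q z -> {for (z, t), continuous (h q)}.

(* By the homotopy extension property, each projection is homotopic to a map
   that is constant on a closed shrinking of [V q]; since these cover, the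
   identity of the product is homotopic to a map omitting the point [- c].
   Performed radially on a thin shell, this homotopy gives a continuous self-map
   of a Euclidean cube fixing the boundary and omitting a point. *)
Lemma sphere_prod_category : False.
Proof.
have [lam [lamc lam1 lam0]] := sphere_prod_shrink c oV covV.
(* Near the complement of [V q] the function [lam q] vanishes, and [h q] at time 0 is the
   projection, so the two branches fit together. *)
pose G q (zt : P * R) := if `[< V q zt.1 >] then h q (zt.1, zt.2 * lam q zt.1) else zt.1 q.
have lam2c q : continuous (fun zt : P * R => lam q zt.1).
  by move=> zt; apply: (cvg_for fst (lamc q zt.1)); exact: cvg_fst.
have Gc q : continuous (G q).
  move=> [z t]; have [Vz|nVz] := pselect (V q z).
    apply: (@cvg_trans _ ((fun zt : P * R => h q (zt.1, zt.2 * lam q zt.1)) @ (z, t))).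
      apply: near_eq_cvg.
      exists (V q, setT); first by split => /=; [apply: open_nbhs_nbhs; split|apply: filterT].
      by move=> [z' t'] /= [Vz' _]; rewrite /G /= asboolT.
    rewrite /G /= asboolT //.
    have hcz := @hc q z (t * lam q z) Vz.
    refine (@cvg_for _ _ (h q) _ (nbhs (z, t))
      (fun zt : P * R => (zt.1, zt.2 * lam q zt.1)) _ hcz _).
    apply: cvg_prodT; first exact: cvg_fst.
    by apply: cvgM; [exact: cvg_snd|exact: (lam2c q (z, t))].
  apply: (@cvg_trans _ ((fun zt : P * R => zt.1 q) @ (z, t))).
    apply: near_eq_cvg.
    exists ([set z' | lam q z' = 0], setT); first by split => /=; [exact: lam0|apply: filterT].
    move=> [z' t'] /= [lz' _]; rewrite /G /=; case: asboolP => //= Vz'.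
    by rewrite lz' mulr0 h0.
  rewrite /G /= asboolF //.
  refine (@cvg_for P _ (fun z => z q) _ (nbhs (z, t)) fst z _ cvg_fst).
  exact: (@prod_coord_continuous I (fun q => sphere R (d q)) q z).
(* One index for each Euclidean coordinate of each factor; [block q] extracts the vector of the
   factor [q]. *)
pose T : finType := {q : I & 'I_(d q).+1}.
pose ix (q : I) (j : 'I_(d q).+1) : 'I_#|T| := enum_rank (Tagged (fun q => 'I_(d q).+1) j : T).
pose block q (x : 'rV[R]_#|T|) : 'rV[R]_(d q).+1 := \row_j x 0 (ix q j).
pose pi (x : 'rV[R]_#|T|) : P := fun q => normalize (c q) (block q x).
pose shell (x : 'rV[R]_#|T|) q := `|sqn (block q x) - 1|.
pose chi (x : 'rV[R]_#|T|) := \prod_(q : I) Num.max 0 (1 - 4 * shell x q).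
have blockc q : continuous (block q).
  move=> x; apply: (@cvg_row _ _ (nbhs x)) => j; rewrite mxE; under eq_fun do rewrite mxE.
  exact: coord_continuous.
have sqnc q : continuous (fun x => sqn (block q x)).
  by move=> x; apply: (@cvg_sqn _ _ _ (nbhs x)); exact: blockc.
have shellc q : continuous (shell^~ q).
  by move=> x; apply: (@cvg_norm _ _ _ (nbhs x)); apply: cvgB; [exact: sqnc|exact: cvg_cst].
have chic : continuous chi.
  move=> x; apply: (@cvg_bigprod _ _ (nbhs x)) => q; apply: cvg_maxr; first exact: cvg_cst.
  apply: cvgB; first exact: cvg_cst.
  by apply: cvgM; [exact: cvg_cst|exact: shellc].
have chi0 x q : 4^-1 <= shell x q -> chi x = 0.
  move=> xq; rewrite /chi (bigD1 q) //= (_ : Num.max _ _ = 0) ?mul0r //.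
  by apply/max_idPl; lra.
have chi1 x : (forall q, sqn (block q x) = 1) -> chi x = 1.
  move=> x1; apply: big1 => q _; rewrite /shell x1 subrr normr0 mulr0 subr0.
  by apply/max_idPr.
have G0 q z : G q (z, 0) = z q.
  by rewrite /G /=; case: asboolP => // Vz; rewrite mul0r h0.
pose thin (x : 'rV[R]_#|T|) := [forall q, shell x q < 2^-1].
(* The bound 1/2 keeps all blocks nonzero, so that [pi] is the radial projection. Once some shell
   value is at least 1/4, [chi] is 0 and [Phi] is the identity, so the branches agree on an
   overlap. *)
pose Phi (x : 'rV[R]_#|T|) (t : T) : R := if thin x then
  Num.sqrt (sqn (block (tag t) x)) * set_val (G (tag t) (pi x, chi x)) 0 (tagged t)
  else x 0 (enum_rank t).
have block_neq0 x q : shell x q < 2^-1 -> block q x != 0.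
  rewrite -sqn_eq0 /shell; apply: contraTneq => ->.
  by rewrite sub0r normrN1 -leNgt; lra.
have PhiE x t q : 4^-1 <= shell x q -> Phi x t = x 0 (enum_rank t).
  move=> xq; rewrite /Phi; case: ifP => // /forallP xthin.
  rewrite (chi0 x q) // G0 /pi set_val_normalize; last exact: block_neq0.
  rewrite mxE mulrA mulfV; last first.
    by rewrite sqrtr_eq0 -ltNge lt_def sqn_ge0 sqn_eq0 block_neq0.
  by rewrite mul1r mxE; congr (x 0 (enum_rank _)); case: (t).
have Phic t : continuous (Phi^~ t).
  move=> x; case: (boolP (thin x)) => [xthin|/forallPn[q]].
    have near_thin : \forall x' \near x, thin x'.
      have : \forall x' \near x, forall q, shell x' q < 2^-1.
        apply: (@filter_forall _ _ _ (nbhs x)) => q.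
        exact: (cvgr_lt (shell x q) (shellc q x) _ (forallP xthin q)).
      by apply: filterS => x' Hx'; apply/forallP.
    apply: (@cvg_trans _ ((fun x' => Num.sqrt (sqn (block (tag t) x')) *
        set_val (G (tag t) (pi x', chi x')) 0 (tagged t)) @ x)).
      by apply: (@near_eq_cvg _ _ (nbhs x)); apply: filterS near_thin => x' Hx'; rewrite /Phi Hx'.
    rewrite /Phi xthin; apply: (@cvgM _ _ (nbhs x)).
      by apply: (@cvg_sqrtr _ _ (nbhs x)); exact: sqnc.
    apply: (@cvg_coord _ _ _ (nbhs x)).
    refine (@cvg_for _ _ set_val _ (nbhs x) (fun x' => G (tag t) (pi x', chi x')) _ _ _).
      exact: set_val_continuous.
    refine (@cvg_for _ _ (G (tag t)) _ (nbhs x) (fun x' => (pi x', chi x')) _ (Gc _ _) _).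
    apply: (@cvg_prodT _ _ _ (nbhs x)); last exact: chic.
    apply: (@cvg_prod_topology _ _ _ (nbhs x)) => q.
    apply: (@cvg_normalize _ _ _ _ (nbhs x)); last exact: blockc.
    by apply: block_neq0; exact: (forallP xthin).
  rewrite -leNgt => xq.
  have xq4 : 4^-1 < shell x q by lra.
  apply: (@cvg_trans _ ((fun x' : 'rV[R]_#|T| => x' 0 (enum_rank t)) @ x)).
    apply: (@near_eq_cvg _ _ (nbhs x)).
    have : \forall x' \near x, 4^-1 < shell x' q.
      exact: (cvgr_gt (shell x q) (shellc q x) _ xq4).
    by apply: filterS => x' xq'; rewrite (PhiE _ _ q) // ltW.
  by rewrite (PhiE _ _ q) ?(ltW xq4) //; exact: coord_continuous.
(* The value to be omitted. Its coordinates lie in [-1, 1] and [Phi] is the identity on the boundary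
   of the cube [-2, 2], so Poincare-Miranda forces [Phi] to take it. *)
pose p q := - set_val (c q).
have pitv (t : T) : -1 <= p (tag t) 0 (tagged t) <= 1.
  by rewrite /p mxE lerNl opprK lerNl andbC sphere_coord_itv.
have far (x : 'rV[R]_#|T|) (t : T) : 4 <= x 0 (enum_rank t) ^+ 2 -> Phi x t = x 0 (enum_rank t).
  move=> x4; rewrite (PhiE _ _ (tag t)) //.
  have : x 0 (enum_rank t) ^+ 2 <= sqn (block (tag t) x).
    rewrite /sqn (bigD1 (tagged t)) //= mxE /ix; case: (t) => q j /=.
    by rewrite lerDl; apply: sumr_ge0 => i _; exact: sqr_ge0.
  by rewrite /shell => H; rewrite ler_normr; apply/orP; left; lra.
have [|t|t x xt|t x xt|x Hx] := @poincare_miranda R #|T|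
    (fun i x => Phi x (enum_val i) - p (tag (enum_val i)) 0 (tagged (enum_val i))) (-2) 2.
- by lra.
- by move=> x; apply: (@cvgB _ _ _ (nbhs x)); [exact: (Phic (enum_val t) x)|exact: cvg_cst].
- have /andP[p1 p2] := pitv (enum_val t).
  by rewrite far enum_valK xt; lra.
- have /andP[p1 p2] := pitv (enum_val t).
  by rewrite far enum_valK xt; lra.
have {}Hx t : Phi x t = p (tag t) 0 (tagged t).
  by apply/eqP; rewrite -subr_eq0; have := Hx (enum_rank t); rewrite enum_rankK => ->.
have sqnp q : sqn (p q) = 1.
  by rewrite /p -scaleN1r sqnZ sqn_sphere mulr1 expr2 mulN1r opprK.
have [xthin|nthin] := boolP (thin x); last first.
  have bx q : block q x = p q.
    by apply/rowP => j; rewrite mxE -(Hx (Tagged (fun q => 'I_(d q).+1) j)) /Phi (negbTE nthin).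
  by case/negP: nthin; apply/forallP => q; rewrite /shell bx sqnp subrr normr0; lra.
have bx q : Num.sqrt (sqn (block q x)) *: set_val (G q (pi x, chi x)) = p q.
  by apply/rowP => j; rewrite mxE -(Hx (Tagged (fun q => 'I_(d q).+1) j)) /Phi xthin.
have sx q : sqn (block q x) = 1.
  by rewrite -(sqnp q) -bx sqnZ sqn_sphere mulr1 sqr_sqrtr ?sqn_ge0.
(* All blocks of [x] are now unit vectors, so [chi x = 1]. Where [lam q] is 1 the homotopy has
   reached its end [c q], which is not [- c q]. *)
have [q lq] := lam1 (pi x).
have Vq : V q (pi x).
  apply: contrapT => /lam0 /nbhs_singleton; rewrite /= lq => /eqP.
  by rewrite oner_eq0.
have := bx q; rewrite sx sqrtr1 scale1r /G /= asboolT // chi1 // mul1r lq h1 //.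
move=> /(congr1 (fun v => sqn (v + set_val (c q)))).
rewrite /p addNr -mulr2n -scaler_nat sqnZ sqn_sphere /sqn.
rewrite [RHS]big1 => [|j _]; last by rewrite mxE expr0n.
by lra.
Qed.

End Category.

(** * Rotations and subcomplexes *)

Section Dot.
Variable R : realType.

Definition dot k (u v : 'rV[R]_k) : R := \sum_j u 0 j * v 0 j.

Lemma dotC k (u v : 'rV[R]_k) : dot u v = dot v u.
Proof. by apply: eq_bigr => j _; rewrite mulrC. Qed.

Lemma dotDl k (u v w : 'rV[R]_k) : dot (u + v) w = dot u w + dot v w.
Proof. by rewrite -big_split; apply: eq_bigr => j _; rewrite mxE mulrDl. Qed.

Lemma dotZl k (a : R) (u v : 'rV[R]_k) : dot (a *: u) v = a * dot u v.
Proof. by rewrite mulr_sumr; apply: eq_bigr => j _; rewrite mxE mulrA. Qed.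

Lemma dotvv k (v : 'rV[R]_k) : dot v v = sqn v.
Proof. by apply: eq_bigr => j _; rewrite expr2. Qed.

Lemma sqnD k (u v : 'rV[R]_k) : sqn (u + v) = sqn u + 2 * dot u v + sqn v.
Proof.
rewrite /sqn /dot mulr_sumr -!big_split; apply: eq_bigr => j _ /=; rewrite mxE.
by ring.
Qed.

Lemma cvg_dot k Z (F : set_system Z) {FF : Filter F} (f g : Z -> 'rV[R]_k)
    (a b : 'rV[R]_k) : f @ F --> a -> g @ F --> b ->
  dot (f x) (g x) @[x --> F] --> dot a b.
Proof.
by move=> fa gb; apply: cvg_bigsum => j; apply: cvgM; exact: cvg_coord.
Qed.

(** The squared distance of two unit vectors is 2 minus twice their product, and vanishes only if
    they coincide. *)
Lemma dot_sphere_lt1 k (x y : sphere R k) : x <> y -> dot (set_val x) (set_val y) < 1.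
Proof.
move=> xy.
have := sqn_ge0 (set_val x - set_val y); have := sqn_eq0 (set_val x - set_val y).
rewrite -scaleN1r sqnD sqnZ !sqn_sphere dotC dotZl dotC scaleN1r subr_eq0.
move=> E0 ge0; rewrite ltNge; apply/negP => d1; apply: xy; apply: val_inj.
by apply/eqP; rewrite -[_ == _]E0; apply/eqP; lra.
Qed.

End Dot.

Section Rotation.
Variables (R : realType) (k : nat).
Hypothesis kodd : odd k.

(** Exchanges the coordinates 2i and 2i + 1; for odd [k] all [k.+1] coordinates are paired. *)
Definition twin (j : 'I_k.+1) : 'I_k.+1 := inord (if odd j then j.-1 else j.+1).

Lemma twinE (j : 'I_k.+1) : twin j = (if odd j then j.-1 else j.+1) :> nat.
Proof.
rewrite inordK //; have := ltn_ord j; case: ifPn => jodd; first by lia.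
by rewrite !ltnS leq_eqVlt => /predU1P[E|//]; rewrite E kodd in jodd.
Qed.

Lemma odd_twin (j : 'I_k.+1) : odd (twin j) = ~~ odd j.
Proof.
by rewrite twinE; case: (nat_of_ord j) => [|m] //=; case: (boolP (odd m)) => /= om; rewrite ?om ?(negbTE om).
Qed.

Lemma twinK : involutive twin.
Proof.
move=> j; apply: val_inj => /=; rewrite twinE odd_twin twinE.
by case: (boolP (odd j)) => //=; case: (nat_of_ord j).
Qed.

(** Multiplication by -i when paired coordinates are read as complex numbers: a unit tangent field
    on the sphere. *)
Definition rot90 (v : 'rV[R]_k.+1) : 'rV[R]_k.+1 :=
  \row_j ((-1) ^+ odd j * v 0 (twin j)).

Lemma sqn_rot90 v : sqn (rot90 v) = sqn v.
Proof.
rewrite [RHS](reindex_inj (inv_inj twinK)); apply: eq_bigr => j _.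
by rewrite mxE exprMn sqrr_sign mul1r.
Qed.

Lemma dot_rot90 v : dot v (rot90 v) = 0.
Proof.
have : dot v (rot90 v) = - dot v (rot90 v); last by lra.
rewrite {1}/dot (reindex_inj (inv_inj twinK)) -sumrN; apply: eq_bigr => j _.
by rewrite !mxE twinK odd_twin; case: odd => /=; ring.
Qed.

Lemma sqn_lincomb_rot90 (a b : R) v :
  sqn (a *: v + b *: rot90 v) = (a ^+ 2 + b ^+ 2) * sqn v.
Proof.
rewrite sqnD !sqnZ sqn_rot90 dotZl dotC dotZl dotC dot_rot90; ring.
Qed.

Lemma cvg_rot90 Z (F : set_system Z) {FF : Filter F} (f : Z -> 'rV[R]_k.+1) a :
  f @ F --> a -> rot90 (f x) @[x --> F] --> rot90 a.
Proof.
move=> fa; apply: cvg_row => j; rewrite mxE; under eq_fun do rewrite mxE.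
by apply: cvgM; [exact: cvg_cst|exact: cvg_coord].
Qed.

End Rotation.

(** * Supports of points, closures of cells and the index *)

Section SubcomplexFacts.
Variables (R : realType) (n : nat) (k : 'I_n -> nat).
Variable e0 : forall i, sphere R (k i).
Hypothesis kodd : forall i, odd (k i).
Implicit Types (x : sphere_product R k) (J : {set 'I_n}).

Definition supp x : {set 'I_n} := [set i | x i != e0 i]%SET.

Lemma cellP J x : cell e0 J x <-> supp x = J.
Proof.
split=> [H|<- i]; last by rewrite inE negbK; split=> [->|/eqP].
apply/setP => i; rewrite inE; apply/idP/idP; apply: contraLR.
  by move=> /H ->; rewrite negbK.
by rewrite negbK => /eqP/H.
Qed.

(** Points of the great circle through the base point and its [rot90], tending to the base point as
    [a] tends to 0. *)
Definition tilt i (a : R) : sphere R (k i) :=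
  normalize (e0 i) (set_val (e0 i) + a *: rot90 (set_val (e0 i))).

Lemma tilt_neq0 i a : set_val (e0 i) + a *: rot90 (set_val (e0 i)) != 0.
Proof.
rewrite -sqn_eq0 -[X in X + _]scale1r sqn_lincomb_rot90 ?kodd // sqn_sphere mulr1.
by rewrite gt_eqF // expr1n ltr_pwDl ?sqr_ge0.
Qed.

Lemma tilt_neq i a : a != 0 -> tilt i a != e0 i.
Proof.
move=> a0; apply/eqP => /(congr1 set_val); rewrite set_val_normalize ?tilt_neq0 //.
set c := (_)^-1; set v := set_val _ => /(congr1 (fun u => u - v)).
rewrite subrr scalerDr scalerA addrAC -{2}[v]scale1r -scalerBl => /(congr1 (@sqn R _)).
rewrite sqn_lincomb_rot90 ?kodd // sqn_sphere mulr1 => /eqP.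
rewrite (_ : sqn 0 = 0); last by apply/eqP; rewrite sqn_eq0.
rewrite paddr_eq0 ?sqr_ge0 // !sqrf_eq0 mulf_eq0 (negbTE a0) orbF invr_eq0 => /andP[_].
by rewrite sqrtr_eq0 leNgt lt_def sqn_ge0 sqn_eq0 tilt_neq0.
Qed.

Lemma cvg_tilt i : tilt i a @[a --> 0^'] --> e0 i.
Proof.
have <- : tilt i 0 = e0 i.
  by rewrite /tilt scale0r addr0 -[set_val (e0 i)]scale1r normalize_sphere.
apply: cvg_normalize; first exact: tilt_neq0.
apply: cvg_row => j; rewrite !mxE; under eq_fun do rewrite !mxE.
apply: cvgD; first exact: cvg_cst.
by apply: cvgM; [exact: nbhs_dnbhs|exact: cvg_cst].
Qed.

(** Tilting the coordinates in [J] that rest at the base point gives points of the cell converging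
    to [x]. *)
Lemma closure_cell J x : supp x \subset J -> closure (cell e0 J) x.
Proof.
move=> xJ B xB.
pose f (a : R) : sphere_product R k := fun i => if i \in J :\: supp x then tilt i a else x i.
have fx : f a @[a --> 0^'] --> x.
  apply: cvg_prod_topology => i; rewrite /f.
  have [iD|iD] := boolP (i \in J :\: supp x); last exact: cvg_cst.
  by move: iD; rewrite !inE negbK => /andP[/eqP -> _]; exact: cvg_tilt.
have fB : \forall a \near (0 : R)^', B (f a) by exact: fx.
have [a [/= Ba a0]] : exists a, B (f a) /\ a != 0.
  have : \forall a \near (0 : R)^', B (f a) /\ a != 0.
    by apply: filterS2 fB (nbhs_dnbhs_neq (0 : R)) => a; split.
  by move=> /(@filter_ex _ _ (Proper_dnbhs_numFieldType _)) [a H]; exists a.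
exists (f a); split => //; apply/cellP/setP => i; rewrite /f !inE.
have := fintype.subsetP xJ i; rewrite inE negbK.
case: (boolP (i \in J)) => [iJ _|_ H].
  by case: (eqVneq (x i) (e0 i)) => [xe|->] //=; rewrite ?xe ?eqxx ?tilt_neq.
by rewrite andbF; apply/idP => /H.
Qed.

Variable X : set (sphere_product R k).
Hypothesis subX : is_subcomplex e0 X.

Lemma supp_index x : X x -> supp x \in index_complex e0 X.
Proof.
case: subX => _ [F XE _] Xx; rewrite inE; apply/asboolP => y /cellP yx.
move: Xx; rewrite XE => -[J JF /cellP xJ]; exists J => //.
by apply/cellP; rewrite yx.
Qed.

(** A point of the cell [J] lies in a cell of the family [F]; equality of supports shows that this
    is the cell [J] itself, whose closure is thus in [X]. *)
Lemma index_sub J x : J \in index_complex e0 X -> supp x \subset J -> X x.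
Proof.
case: subX => _ [F XE clF]; rewrite inE => /asboolP JX xJ.
have [y yJ] : exists y, supp y = J.
  exists (fun i => if i \in J then tilt i 1 else e0 i); apply/setP => i.
  by rewrite inE; case: ifP; rewrite ?eqxx ?tilt_neq ?oner_neq0.
have : X y by apply: JX; apply/cellP.
rewrite {1}XE => -[J' /= J'F /cellP yJ'].
by apply: (clF J') => //; apply: closure_cell; rewrite -yJ' yJ.
Qed.

Lemma index_nonempty : exists J, J \in index_complex e0 X.
Proof. by have [[x Xx] _] := subX; exists (supp x); exact: supp_index. Qed.

End SubcomplexFacts.

(** * The wedge of intervals *)

Lemma set_type_hausdorff (X : topologicalType) (A : set X) :
  hausdorff_space X -> hausdorff_space (set_type A).
Proof.
move=> hX p q clpq; apply: val_inj; apply: hX => B C pB qC.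
have [z [Bz Cz]] := clpq _ _ (set_val_continuous pB) (set_val_continuous qC).
by exists (set_val z).
Qed.

Section Wedge.
Variables (R : realType) (s : nat).

(** Retraction of the line onto the interval, which lets paths in the wedge be written with a real
    parameter. *)
Definition clamp01 (t : R) : unit_interval R :=
  insubd (unit_interval0 R) (Num.max 0 (Num.min 1 t)).

Lemma val_clamp01 t : set_val (clamp01 t) = Num.max 0 (Num.min 1 t).
Proof.
rewrite [LHS]val_insubd ifT //; apply/mem_set; rewrite /= in_itv /=.
by rewrite le_max lexx /= ge_max ler01 ge_min lexx.
Qed.

Lemma clamp01_0 t : t <= 0 -> clamp01 t = unit_interval0 R.
Proof.
move=> t0; apply: val_inj; rewrite -[LHS]/(set_val _) val_clamp01.
by rewrite (min_idPr _) ?(le_trans t0) // (max_idPl t0).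
Qed.

Lemma clamp01_1 t : 1 <= t -> clamp01 t = unit_interval1 R.
Proof.
move=> t1; apply: val_inj; rewrite -[LHS]/(set_val _) val_clamp01.
by rewrite (min_idPl t1) (max_idPr ler01).
Qed.

Lemma clamp01_continuous : continuous clamp01.
Proof.
move=> t; apply: (@cvg_set_type _ _ _ (nbhs t)); rewrite val_clamp01.
have -> : set_val \o clamp01 = fun u : R => Num.max 0 (Num.min 1 u).
  by apply/funext => u; exact: val_clamp01.
apply: cvg_maxr; first exact: cvg_cst.
rewrite minr_absE.
rewrite (_ : Num.min 1 = fun u : R => (1 + u - `|1 - u|) / 2); last first.
  by apply/funext => u; exact: minr_absE.
apply: cvgM; last exact: cvg_cst.
apply: cvgB; first by apply: cvgD; [exact: cvg_cst|exact: cvg_id].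
by apply: cvg_norm; apply: cvgB; [exact: cvg_cst|exact: cvg_id].
Qed.

Lemma unit_interval_compact : compact [set: unit_interval R].
Proof. by apply: compact_set_type; exact: segment_compact. Qed.

Lemma unit_interval_hausdorff : hausdorff_space (unit_interval R).
Proof. by apply: set_type_hausdorff; exact: Rhausdorff. Qed.

Lemma interval_wedge_compact : compact [set: interval_wedge R s].
Proof.
apply: wedge_compact => [|i]; first exact: finite_finset.
exact: unit_interval_compact.
Qed.

Lemma interval_wedge_hausdorff : hausdorff_space (interval_wedge R s).
Proof. by apply: wedge_hausdorff => i; exact: unit_interval_hausdorff. Qed.

Definition arm (l : 'I_s) (t : unit_interval R) : interval_wedge R s :=
  @wedge_lift _ _ (fun=> unit_interval0 R) l t.

Lemma arm_continuous l : continuous (arm l).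
Proof. exact: (@wedge_lift_continuous _ _ (fun=> unit_interval0 R) l). Qed.

Lemma arm0 l l' : arm l (unit_interval0 R) = arm l' (unit_interval0 R).
Proof.
exact: (@wedge_liftE _ _ (fun=> unit_interval0 R) l' (unit_interval0 R) l (unit_interval0 R)).
Qed.

(** The wedge is compact and Hausdorff, so evaluation is jointly continuous for the compact-open
    topology. *)
Lemma multipath_eval_continuous (Y : topologicalType) :
  continuous (fun fw : multipath R s Y * interval_wedge R s =>
    (fw.1 : continuousType (interval_wedge R s) Y) fw.2).
Proof.
have lc : locally_compact [set: interval_wedge R s].
  move=> x _; exists setT; first exact: filterT.
  by split; [exact: interval_wedge_compact|exact: closedT].
have reg : regular_space (interval_wedge R s).
  move=> x; apply: (@compact_regular _ x setT); last exact: filterT.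
    exact: interval_wedge_hausdorff.
  exact: interval_wedge_compact.
have := @eval_continuous (interval_wedge R s) Y lc reg.
rewrite (_ : eval = fun fw : continuousType (interval_wedge R s) Y * interval_wedge R s =>
  fw.1 fw.2); first by [].
by apply/funext => -[f x].
Qed.

End Wedge.

Lemma glue_continuous (R : realType) (Y : topologicalType) (a b : R -> Y) (c : R) :
  continuous a -> continuous b -> a c = b c ->
  continuous (fun t => if t <= c then a t else b t).
Proof.
move=> ca cb abc t; have [tc|ct|->] := ltgtP t c.
- apply: (@cvg_trans _ (a @ t)); last by rewrite (ltW tc); exact: (ca t).
  apply: (@near_eq_cvg _ _ (nbhs t)); near=> t'; rewrite ifT // ltW //; near: t'.
  exact: (cvgr_lt t (@cvg_id _ (nbhs t)) c tc).
- apply: (@cvg_trans _ (b @ t)); last by rewrite leNgt ct; exact: (cb t).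
  apply: (@near_eq_cvg _ _ (nbhs t)); near=> t'; rewrite ifF //; apply/negbTE; rewrite -ltNge; near: t'.
  exact: (cvgr_gt t (@cvg_id _ (nbhs t)) c ct).
- move=> B; rewrite lexx => Bc; have Bc' : nbhs (b c) B by rewrite -abc.
  have aB : \forall t' \near c, B (a t') by exact: (ca c).
  have bB : \forall t' \near c, B (b t') by exact: (cb c).
  by apply: (@filterS2 _ (nbhs c) _ _ _ _ _ aB bB) => t' {}aB {}bB /=; case: ifP.
Unshelve. all: by end_near. Qed.

(** * The lower bound *)

Lemma card_sum_mem (T : finType) (A : {set T}) : #|A| = (\sum_(x : T) (x \in A))%N.
Proof. by rewrite -sum1_card big_mkcond; apply: eq_bigr => x _; case: (_ \in _). Qed.

Section FreePositions.
Variables (n s : nat) (J : {ffun 'I_s -> {set 'I_n}}).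

(* The coordinates [p.2] of the factors [p.1] kept when one factor is set to
   the base point in each coordinate shared by all the [J l]. *)
Definition free_positions : {set 'I_s * 'I_n} :=
  [set p | (p.2 \in J p.1) && ((0 < p.1)%N || [exists l, p.2 \notin J l])]%SET.

(** Supplies the factor whose coordinate [p.2] is held at the base point, towards which a section
    contracts the coordinate [p]: one with [p.2] outside [J l], or else the factor 0. *)
Lemma free_positions_avoid p : p \in free_positions ->
  exists l, (l, p.2) \notin free_positions.
Proof.
rewrite inE => /andP[_]; case: (boolP [exists l, _]) => [/existsP[l il] _|nex].
  by exists l; rewrite inE (negbTE il).
rewrite orbF => p0; have s0 : (0 < s)%N by apply: leq_ltn_trans (ltn_ord p.1).
by exists (Ordinal s0); rewrite inE /= (negbTE nex) andbF.
Qed.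

(** Positions with [0 < l] account for the cardinals of the [J l]. For fixed [i] at most one [l],
    the first with [i] outside [J l], contributes to the differences; then [i] is in the first
    simplex but not in all, so [(0, i)] is free. *)
Lemma normJ_le_free : (normJ J <= #|free_positions|)%N.
Proof.
rewrite /normJ card_sum_mem
  (eq_bigr (fun p : 'I_s * 'I_n => ((p.1, p.2) \in free_positions : nat)));
  last by case.
rewrite -(pair_bigA _ (fun l i => ((l, i) \in free_positions : nat))) /= exchange_big /=.
under eq_bigr do rewrite !card_sum_mem -big_split /=.
rewrite exchange_big; apply: leq_sum => i _ /=.
rewrite [leqRHS](bigID (fun l : 'I_s => (0 < l)%N)) /= big_split /= addnC.
apply: leq_add.
  by apply: leq_sum => l l0; rewrite inE /= l0 andbT.
case: (boolP [exists l : 'I_s, (0 < l)%N && (i \in (\bigcap_(m < s | (m < l)%N) J m) :\: J l)%SET]).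
  move=> /existsP[l /andP[l0 /finset.setDP[/finset.bigcapP iJm iJl]]].
  have s0 : (0 < s)%N by apply: leq_ltn_trans (ltn_ord l).
  rewrite [leqLHS](bigD1 l) //= [X in (_ + X <= _)%N]big1 ?addn0 => [|l' /andP[l'0 l'l]].
    apply: (leq_trans (leq_b1 _)); rewrite (bigD1 (Ordinal s0)) //=.
    rewrite [X in (_ <= X + _)%N](_ : _ = 1%N) ?leq_addr // inE /= iJm //=.
    by rewrite (_ : [exists _, _]) //; apply/existsP; exists l.
  apply/eqP; rewrite eqb0; apply/negP => /finset.setDP[/finset.bigcapP iJm' iJl'].
  move: l'l; rewrite neq_ltn => /orP[l'l|ll'].
    by rewrite iJm in iJl'.
  by rewrite iJm' in iJl.
rewrite negb_exists => /forallP H; rewrite big1 // => l l0.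
by apply/eqP; rewrite eqb0; move: (H l); rewrite l0.
Qed.

End FreePositions.

(** * Contracting the free coordinates along sections *)

Section LowerBound.
Variables (R : realType) (s n : nat) (k : 'I_n -> nat).
Variables (e0 : forall i : 'I_n, sphere R (k i)) (X : set (sphere_product R k)).
Hypothesis kodd : forall i, odd (k i).
Hypothesis subX : is_subcomplex e0 X.

(** Extension by a constant multipath; openness of [U] preserves continuity at its points. *)
Lemma section_extension (Y : topologicalType) (U : set (cartesian_power s Y)) (b : Y) :
  open U -> has_section_on R U ->
  exists sg : cartesian_power s Y -> multipath R s Y,
    (forall y, U y -> {for y, continuous sg}) /\ (forall y, U y -> endpoints (sg y) = y).
Proof.
move=> oU [f fc fend].
pose d : multipath R s Y := (cst b : continuousType (interval_wedge R s) Y).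
exists (valL_ d f); split=> y Uy.
  have : {within U, continuous (valL_ d f)} by exact/subspace_valL_continuousP'.
  by rewrite continuous_open_subspace // => H; apply: H; exact/mem_set.
by have := fend (SigSub (mem_set Uy)); rewrite -{1}[f](@valLK _ _ d U).
Qed.

Lemma normX_le_of_cover m : motion_planning_cover R s (set_type X) m ->
  (normX e0 s X <= m)%N.
Proof.
move=> [U [oU covU secU]].
apply/bigmax_leqP => J /forallP JK; rewrite leqNgt; apply/negP => ltmJ.
pose Q := free_positions J.
have cardQ : (m < #|Q|)%N := leq_trans ltmJ (normJ_le_free J).
pose P := prod_topology (fun p : 'I_s * 'I_n => sphere R (k p.2)).
(* The factors of [P] are indexed by all positions, but only the free ones are used; the support of
   the [l]-th point stays in [J l]. *)
pose pt (z : P) l : sphere_product R k := fun i => if (l, i) \in Q then z (l, i) else e0 i.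
have Xpt z l : X (pt z l).
  apply: (index_sub kodd subX (JK l)); apply/fintype.subsetP => i.
  by rewrite inE /pt; case: ifP; rewrite ?eqxx // inE => /andP[].
pose iota (z : P) : cartesian_power s (set_type X) := fun l => SigSub (mem_set (Xpt z l)).
have iota_c : continuous iota.
  move=> z; apply: (@cvg_prod_topology _ _ _ (nbhs z)) => l.
  apply: (@cvg_set_type _ _ _ (nbhs z)).
  apply: (@cvg_prod_topology _ _ _ (nbhs z)) => i;
  suff : (fun z' => pt z' l i) @ nbhs z --> pt z l i by [].
  rewrite /pt; case: ((l, i) \in Q); last exact: (@cvg_cst _ (e0 i) _ (nbhs z)).
  exact: (@prod_coord_continuous _ (fun p : 'I_s * 'I_n => sphere R (k p.2)) (l, i)).
have Xe0 : X e0.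
  have [J0 J0K] := index_nonempty subX; apply: (index_sub kodd subX J0K).
  by apply/fintype.subsetP => i; rewrite inE eqxx.
pose b : set_type X := SigSub (mem_set Xe0).
have /choice[sg sgP] := fun j => section_extension b (oU j) (secU j).
(* The j-th free position is paired with the j-th set of the cover. Each of the [m.+1] sets is used
   because [m < #|Q|]; the remaining positions get an empty [V p]. *)
pose jx p : 'I_m.+1 := inord (index p (enum Q)).
pose V p : set P := [set z | [/\ p \in Q, (index p (enum Q) < m.+1)%N & U (jx p) (iota z)]].
have oV p : open (V p).
  have [pQ|pQ] := boolP (p \in Q); last first.
    by rewrite (_ : V p = set0) ?openE //; apply/seteqP; split=> z //= [/(negP pQ)].
  have [pm|pm] := boolP (index p (enum Q) < m.+1)%N; last first.
    by rewrite (_ : V p = set0) ?openE //; apply/seteqP; split=> z //= [_ /(negP pm)].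
  rewrite (_ : V p = iota @^-1` U (jx p)); last by apply/seteqP; split=> z //= [].
  by apply: open_comp; [move=> z _; exact: iota_c|exact: oU].
have covV z : exists p, V p z.
  have : (\bigcup_i U i) (iota z) by rewrite covU.
  move=> [j _ Uj]; have jQ : (j < size (enum Q))%N.
    by rewrite -cardE (leq_trans (ltn_ord j)).
  have [p0 _] : exists p0, p0 \in enum Q.
    by case: (enum Q) jQ => // p0 t _; exists p0; rewrite mem_head.
  exists (nth p0 (enum Q) j); rewrite /V /= /jx index_uniq ?enum_uniq // inord_val.
  by split=> //; rewrite -mem_enum mem_nth.
have /choice[av avP] : forall p, exists l, p \in Q -> (l, p.2) \notin Q.
  move=> p; have [pQ|pQ] := boolP (p \in Q); last by exists p.1.
  by have [l lQ] := free_positions_avoid pQ; exists l.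
(* From the end of arm [p.1] to the wedge point at time 1/2, then out to the end of arm [av p],
   where the coordinate [p.2] is at the base point. *)
pose w (p : 'I_s * 'I_n) (t : R) : interval_wedge R s :=
  if t <= 2^-1 then arm p.1 (clamp01 (1 - 2 * t)) else arm (av p) (clamp01 (2 * t - 1)).
have w_c p : continuous (w p).
  apply: (@glue_continuous R (interval_wedge R s) (fun t => arm p.1 (clamp01 (1 - 2 * t)))
    (fun t => arm (av p) (clamp01 (2 * t - 1)))).
  - move=> t; refine (@cvg_for _ _ (arm p.1) _ (nbhs t) _ _ (@arm_continuous _ _ _ _) _).
    refine (@cvg_for _ _ (@clamp01 R) _ (nbhs t) _ _ (@clamp01_continuous _ _) _).
    by apply: cvgB; [exact: cvg_cst|apply: cvgM; [exact: cvg_cst|exact: cvg_id]].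
  - move=> t; refine (@cvg_for _ _ (arm (av p)) _ (nbhs t) _ _ (@arm_continuous _ _ _ _) _).
    refine (@cvg_for _ _ (@clamp01 R) _ (nbhs t) _ _ (@clamp01_continuous _ _) _).
    by apply: cvgB; [apply: cvgM; [exact: cvg_cst|exact: cvg_id]|exact: cvg_cst].
  - by rewrite !clamp01_0 ?(arm0 R p.1 (av p)) //; lra.
pose h p (zt : P * R) : sphere R (k p.2) :=
  set_val ((sg (jx p) (iota zt.1) : continuousType (interval_wedge R s) (set_type X))
    (w p zt.2)) p.2.
apply: (@sphere_prod_category R _ (fun p : 'I_s * 'I_n => k p.2) V h (fun p => e0 p.2)) => //.
- move=> p z [pQ _ Up]; rewrite /h /w /= ifT ?invr_ge0 // clamp01_1; last by lra.
  rewrite -[X in set_val X]/(endpoints (sg (jx p) (iota z)) p.1).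
  rewrite (proj2 (sgP _)) //; suff : pt z p.1 p.2 = z p by [].
  by move: pQ; rewrite /pt; case: (p) => l i /= ->.
- move=> p z [pQ _ Up]; rewrite /h /w /= ifF; last by lra.
  rewrite clamp01_1; last by lra.
  rewrite -[X in set_val X]/(endpoints (sg (jx p) (iota z)) (av p)).
  rewrite (proj2 (sgP _)) //; suff : pt z (av p) p.2 = e0 p.2 by [].
  by rewrite /pt (negbTE (avP _ _)).
move=> p z t [pQ _ Up].
pose g (zt : P * R) : set_type X :=
  (sg (jx p) (iota zt.1) : continuousType (interval_wedge R s) (set_type X)) (w p zt.2).
refine (@cvg_for _ _ (fun x : sphere_product R k => x p.2) _ (nbhs (z, t))
  (fun zt => set_val (g zt)) _ (@prod_coord_continuous _ _ _ _) _).
refine (@cvg_for _ _ set_val _ (nbhs (z, t)) g _ (@set_val_continuous _ _ _) _).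
refine (@cvg_for _ _ (fun fw : multipath R s (set_type X) * interval_wedge R s =>
    (fw.1 : continuousType (interval_wedge R s) (set_type X)) fw.2)
  _ (nbhs (z, t)) (fun zt : P * R => (sg (jx p) (iota zt.1), w p zt.2))
  (sg (jx p) (iota z), w p t) (@multipath_eval_continuous _ _ _ _) _).
apply: (@cvg_prodT _ _ _ (nbhs (z, t))).
  refine (@cvg_for _ _ (sg (jx p)) _ (nbhs (z, t)) (iota \o fst) _ (proj1 (sgP _) _ Up) _).
  refine (@cvg_for _ _ iota _ (nbhs (z, t)) fst _ (iota_c z) _).
  exact: cvg_fst.
refine (@cvg_for _ _ (w p) _ (nbhs (z, t)) snd _ (w_c p t) _).
exact: cvg_snd.
Qed.

End LowerBound.

(** * Motion planning on an odd sphere *)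

Section Planner.
Variables (R : realType) (k : nat) (e : sphere R k).
Hypothesis kodd : odd k.
Implicit Types (x y : sphere R k) (t : R).

Local Notation vec x := (set_val x : 'rV[R]_k.+1).

Lemma normalize_id x : normalize e (vec x) = x.
Proof. by rewrite -[vec x]scale1r normalize_sphere. Qed.

(** Half the squared distance to [e]. *)
Definition height x : R := 1 - dot (vec x) (vec e).

Lemma height_ge0 x : 0 <= height x.
Proof.
rewrite subr_ge0; have [->|/eqP/dot_sphere_lt1/ltW//] := eqVneq x e.
by rewrite dotvv sqn_sphere.
Qed.

Lemma height_e : height e = 0.
Proof. by rewrite /height dotvv sqn_sphere subrr. Qed.

Lemma height_gt0 x : x <> e -> 0 < height x.
Proof. by move/dot_sphere_lt1; rewrite subr_gt0. Qed.

Definition before t : R := Num.max 0 (1 - 2 * t).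
Definition after t : R := Num.max 0 (2 * t - 1).

Lemma before_after t : 0 <= t <= 1 ->
  (t <= 2^-1 /\ before t = 1 - 2 * t /\ after t = 0) \/
  (2^-1 <= t /\ before t = 0 /\ after t = 2 * t - 1).
Proof.
move=> /andP[t0 t1]; have [th|th] := leP t 2^-1; [left|right]; split=> //; rewrite ?(ltW th) //;
  split.
- by apply/max_idPr; lra.
- by apply/max_idPl; lra.
- by apply/max_idPl; lra.
- by apply/max_idPr; lra.
Qed.

(** Weight of [e] in the short motion. It keeps the vector nonzero near [x = y = e], where both
    heights vanish. *)
Definition near_e x y : R := Num.max 0 (2^-1 - height x - height y).

(* Straight motion from [x] to a point between [x], [y] and [e], which is [e]
   as soon as [x = e] or [y = e], and from there to [y]. *)
Definition short_vec x y t : 'rV[R]_k.+1 :=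
  let q := 1 - before t - after t in
  (before t + q * height y) *: vec x + (after t + q * height x) *: vec y
  + (q * near_e x y) *: vec e.

(* Motion from [x] to [- x] through [rot90 x], followed by the straight motion
   from [- x] to [y]; the time is reparametrized so as to stay at [x] before
   time 1/2 if [x = e], and at [y] after time 1/2 if [y = e]. *)
Definition long_time x y t : R :=
  3 * (((1 - before t) * height x + after t * height y) / (height x + height y)).

Definition long_vec x y t : 'rV[R]_k.+1 :=
  let u := long_time x y t in
  Num.max (1 - u) (u - 3) *: vec x + Num.max 0 (1 - `|u - 1|) *: rot90 (vec x)
  + Num.max 0 (u - 2) *: vec y.

Definition plan (b : bool) x y t : sphere R k :=
  normalize e (if b then short_vec x y t else long_vec x y t).

Definition plan_dom (b : bool) x y : Prop :=
  if b return Prop then - 1 < dot (vec x) (vec y) else x <> y.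

(** Away from [e] the vector is a nonnegative combination of [x] and [y], not both coefficients
    zero, and [y] is not antipodal to [x]. Near [e] both points have product above 1/2 with [e], and
    the product of the vector with [e] is positive. *)
Lemma short_vec_neq0 x y t : 0 <= t <= 1 -> plan_dom true x y -> short_vec x y t != 0.
Proof.
move=> t01 /= xy; rewrite /short_vec.
have := height_ge0 x; have := height_ge0 y.
set a := height x; set b := height y; set p := before t; set r := after t.
move=> b0 a0.
have [p0 [r0 [q0 pr]]] : 0 <= p /\ 0 <= r /\ 0 <= 1 - p - r /\ (p = 0 \/ r = 0).
  by move/andP: (t01) => [t0 t1]; rewrite /p /r; case: (before_after t01) => -[th [-> ->]];
    (split; [lra|split; [lra|split; [lra|]]]); [right|left].
set q := 1 - p - r in q0 *.
have [ab|ab] := leP 2^-1 (a + b).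
  rewrite (_ : near_e x y = 0) ?mulr0 ?scale0r ?addr0;
    last by apply/max_idPl; rewrite -/a -/b; lra.
  rewrite -sqn_eq0 sqnD !sqnZ !sqn_sphere !mulr1 dotZl dotC dotZl dotC.
  set A := p + q * b; set B := r + q * a; set d := dot _ _ in xy *.
  have A0 : 0 <= A by rewrite /A; nra.
  have B0 : 0 <= B by rewrite /B; nra.
  have AB : 0 < A + B.
    have h : q * 2^-1 <= q * (a + b) by apply: ler_wpM2l.
    rewrite (_ : A + B = p + r + q * (a + b)); last by rewrite /A /B; ring.
    have : p + r + q = 1 by rewrite /q; ring.
    by lra.
  rewrite (_ : _ + _ + _ = (A - B) ^+ 2 + 2 * (A * B) * (1 + d)); last by ring.
  have [E|E] := eqVneq A B.
    have : 0 < A * B by rewrite -E mulr_gt0 //; lra.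
    move=> H; rewrite gt_eqF // ltr_wpDl ?sqr_ge0 // !mulr_gt0 //; lra.
  rewrite gt_eqF // ltr_pwDl // ?exprn_even_gt0 ?subr_eq0 //.
  by rewrite !mulr_ge0 //; lra.
apply/eqP => /(congr1 (fun v => dot v (vec e))).
rewrite !dotDl !dotZl (_ : dot 0 _ = 0); last first.
  by rewrite /dot big1 // => j _; rewrite mxE mul0r.
rewrite dotvv sqn_sphere.
have -> : dot (vec x) (vec e) = 1 - a by rewrite /a /height; ring.
have -> : dot (vec y) (vec e) = 1 - b by rewrite /b /height; ring.
rewrite (_ : near_e x y = 2^-1 - a - b); last by apply/max_idPr; rewrite -/a -/b; lra.
move=> H; have : 0 < (p + q * b) * (1 - a) + (r + q * a) * (1 - b) + q * (2^-1 - a - b) * 1.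
  have qb : 0 <= q * b by rewrite mulr_ge0.
  have qa : 0 <= q * a by rewrite mulr_ge0.
  have h1 : (p + q * b) * 2^-1 <= (p + q * b) * (1 - a) by apply: ler_wpM2l; lra.
  have h2 : (r + q * a) * 2^-1 <= (r + q * a) * (1 - b) by apply: ler_wpM2l; lra.
  have qq : p + r + q = 1 by rewrite /q; ring.
  have : q * (2^-1 - a - b) = 2^-1 * q - q * a - q * b by ring.
  move=> ->.
  have h3 : q * a <= q * 2^-1 by apply: ler_wpM2l; lra.
  have h4 : q * a + q * b <= q * 2^-1 by rewrite -mulrDr; apply: ler_wpM2l; lra.
  have [q1|q1] := leP q 2^-1; first by lra.
  have h5 : q * (a + b) < q * 2^-1 by rewrite ltr_pM2l //; lra.
  by lra.
by rewrite H ltxx.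
Qed.

Lemma height_sum_gt0 x y : x <> y -> 0 < height x + height y.
Proof.
have := height_ge0 x; have := height_ge0 y => y0 x0 xy.
have [xe|/eqP/height_gt0 xe] := eqVneq x e; last by lra.
have [ye|/eqP/height_gt0 ye] := eqVneq y e; last by lra.
by case: xy; rewrite xe ye.
Qed.

(** Up to [u = 2] the vector combines the orthogonal vectors [x] and [rot90 x]; afterwards it runs
    along the segment from [- x] to [y], which avoids 0 because [x] and [y] differ. *)
Lemma long_vec_neq0 x y t : 0 <= t <= 1 -> x <> y -> long_vec x y t != 0.
Proof.
move=> t01 xy; rewrite /long_vec.
have := height_ge0 x; have := height_ge0 y; have := height_sum_gt0 xy.
set a := height x; set b := height y; move=> ab b0 a0.
have u3 : long_time x y t <= 3.
  rewrite /long_time -/a -/b -[leRHS]mulr1; apply: ler_wpM2l => //.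
  rewrite ler_pdivrMr // mul1r.
  by move/andP: (t01) => [t0 t1]; case: (before_after t01) => -[th [-> ->]]; nra.
set u := long_time x y t in u3 *.
have [u2|u2] := leP u 2.
  rewrite (max_idPl (_ : u - 2 <= 0)); last by lra.
  rewrite scale0r addr0 -sqn_eq0 sqn_lincomb_rot90 // sqn_sphere mulr1.
  rewrite (max_idPl (_ : u - 3 <= 1 - u)); last by lra.
  have [->|u1] := eqVneq u 1.
    by rewrite !subrr normr0 subr0 (max_idPr ler01) expr0n expr1n add0r oner_eq0.
  rewrite gt_eqF // ltr_pwDl ?sqr_ge0 // exprn_even_gt0 //= subr_eq0 eq_sym.
  exact: u1.
rewrite (max_idPr (_ : 1 - u <= u - 3)); last by lra.
rewrite (max_idPr (_ : 0 <= u - 2)); last by lra.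
rewrite (max_idPl (_ : 1 - `|u - 1| <= 0)); last by rewrite ger0_norm; lra.
rewrite scale0r addr0 -sqn_eq0 sqnD !sqnZ !sqn_sphere !mulr1 dotZl dotC dotZl dotC.
have := dot_sphere_lt1 xy; set d := dot _ _ => d1.
rewrite (_ : _ + _ + _ = 1 - 2 * ((3 - u) * (u - 2)) * (1 + d)); last by ring.
have h0 : 0 <= (3 - u) * (u - 2) by apply: mulr_ge0; lra.
have [d0|d0] := leP (1 + d) 0.
  have := mulr_ge0_le0 h0 d0; set m := _ * (1 + d) => m0.
  by rewrite -mulrA -/m gt_eqF //; lra.
have h : (3 - u) * (u - 2) <= 4^-1.
  by rewrite -subr_ge0 (_ : _ - _ = (u - 5 / 2) ^+ 2) ?sqr_ge0 //; lra.
have hm : (3 - u) * (u - 2) * (1 + d) <= 4^-1 * (1 + d).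
  by apply: ler_wpM2r => //; exact: ltW.
by rewrite -mulrA gt_eqF //; move: hm; set m := _ * (1 + d) => hm; lra.
Qed.

Lemma long_vec_end x y t : long_time x y t = 3 -> long_vec x y t = vec y.
Proof.
move=> E; rewrite /long_vec E (max_idPr _); last by lra.
rewrite (max_idPl _); last by rewrite ger0_norm; lra.
have E1 : 3 - 2 = 1 :> R by lra.
by rewrite subrr E1 (max_idPr ler01) !scale0r !add0r scale1r.
Qed.

Lemma long_vec_start x y t : long_time x y t = 0 -> long_vec x y t = vec x.
Proof.
move=> E; rewrite /long_vec E !sub0r normrN1 subrr subr0 maxxx.
rewrite (max_idPl (_ : - 3 <= 1)); last by lra.
rewrite (max_idPl (_ : - 2 <= 0)); last by lra.
by rewrite !scale0r !addr0 scale1r.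
Qed.

Lemma plan0 b x y : plan b x y 0 = x.
Proof.
have p0 : before 0 = 1 by rewrite /before mulr0 subr0 (max_idPr ler01).
have r0 : after 0 = 0 by rewrite /after mulr0 sub0r; apply/max_idPl; lra.
rewrite -[RHS]normalize_id; congr normalize; case: b.
  by rewrite /short_vec p0 r0 subrr subr0 !mul0r !addr0 !scale0r !addr0 scale1r.
by rewrite long_vec_start // /long_time p0 r0 subrr !mul0r addr0 mul0r mulr0.
Qed.

Lemma plan1 b x y : plan_dom b x y -> plan b x y 1 = y.
Proof.
have p0 : before 1 = 0 by apply/max_idPl; lra.
have r0 : after 1 = 1 by rewrite /after (_ : 2 * 1 - 1 = 1) ?(max_idPr ler01) //; ring.
move=> dom; rewrite -[RHS]normalize_id; congr normalize.
case: b dom => /= dom.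
  by rewrite /short_vec p0 r0 subr0 subrr !mul0r !addr0 !scale0r !add0r addr0 scale1r.
apply: long_vec_end; rewrite /long_time p0 r0 subr0 !mul1r divff ?mulr1 //.
by rewrite gt_eqF // height_sum_gt0.
Qed.

(** In the short motion the coefficient of [y] vanishes and that of [e] stays positive; in the long
    one [long_time] is 0. *)
Lemma plan_base_start b y t : 0 <= t <= 1 -> t <= 2^-1 -> plan b e y t = e.
Proof.
move=> t01 th.
have [p1 r0] : before t = 1 - 2 * t /\ after t = 0.
  by move/andP: t01 => [t0 t1]; split; [apply/max_idPr; lra|apply/max_idPl; lra].
case: b; rewrite /plan; last first.
  rewrite long_vec_start ?normalize_id //.
  by rewrite /long_time height_e r0 mulr0 mul0r addr0 mul0r mulr0.
rewrite /short_vec height_e r0 mulr0 !addr0 scale0r addr0 -scalerDl normalize_sphere //.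
rewrite p1 /near_e height_e.
have y0 := height_ge0 y; move/andP: t01 => [t0 t1].
have n0 : 2^-1 - height y <= Num.max 0 (2^-1 - 0 - height y) by rewrite le_max subr0 lexx orbT.
have n1 : 0 <= Num.max 0 (2^-1 - 0 - height y) by rewrite le_max lexx.
set m := Num.max _ _ in n0 n1 *.
rewrite [ltRHS](_ : _ = 1 - 2 * t + 2 * t * (height y + m)); last by ring.
by nra.
Qed.

Lemma plan_base_end b x t : 0 <= t <= 1 -> 2^-1 <= t -> plan b x e t = e.
Proof.
move=> t01 th.
have [p0 r1] : before t = 0 /\ after t = 2 * t - 1.
  by move/andP: t01 => [t0 t1]; split; [apply/max_idPl; lra|apply/max_idPr; lra].
case: b; rewrite /plan; last first.
  (* For [x = y = e], outside the domain of the long motion, the quotient in [long_time] is 0/0 = 0,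
     so the point still rests at [e]. *)
  have [->|xe] := eqVneq x e.
    rewrite long_vec_start ?normalize_id //.
    by rewrite /long_time height_e !mulr0 addr0 mul0r mulr0.
  rewrite long_vec_end ?normalize_id //.
  rewrite /long_time height_e p0 mulr0 !addr0 subr0 mul1r divff ?mulr1 //.
  by rewrite gt_eqF // height_gt0 //; exact/eqP.
rewrite /short_vec height_e p0 mulr0 !addr0 scale0r add0r -scalerDl normalize_sphere //.
rewrite r1 /near_e height_e.
have x0 := height_ge0 x; move/andP: t01 => [t0 t1].
have n0 : 2^-1 - height x <= Num.max 0 (2^-1 - height x - 0) by rewrite le_max subr0 lexx orbT.
have n1 : 0 <= Num.max 0 (2^-1 - height x - 0) by rewrite le_max lexx.
set m := Num.max _ _ in n0 n1 *.
rewrite [ltRHS](_ : _ = 2 * t - 1 + (2 - 2 * t) * (height x + m)); last by ring.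
by nra.
Qed.

Section CvgPlan.
Context (Z : Type) (F : set_system Z) {FF : Filter F}.
Variables (f g : Z -> sphere R k) (h : Z -> R) (x y : sphere R k) (t : R).
Hypotheses (fx : f @ F --> x) (gy : g @ F --> y) (ht : h @ F --> t).

Let cvg_vec (f' : Z -> sphere R k) (x' : sphere R k) : f' @ F --> x' ->
  vec (f' z) @[z --> F] --> vec x'.
Proof. by move=> H; refine (@cvg_for _ _ set_val _ F f' _ (@set_val_continuous _ _ _) H). Qed.

Let cvg_height (f' : Z -> sphere R k) (x' : sphere R k) : f' @ F --> x' ->
  height (f' z) @[z --> F] --> height x'.
Proof.
move=> H; apply: cvgB; first exact: cvg_cst.
by apply: cvg_dot; [exact: cvg_vec|exact: cvg_cst].
Qed.

Let cvg_before : before (h z) @[z --> F] --> before t.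
Proof.
apply: cvg_maxr; first exact: cvg_cst.
by apply: cvgB; [exact: cvg_cst|apply: cvgM => //; exact: cvg_cst].
Qed.

Let cvg_after : after (h z) @[z --> F] --> after t.
Proof.
apply: cvg_maxr; first exact: cvg_cst.
by apply: cvgB; [apply: cvgM => //; exact: cvg_cst|exact: cvg_cst].
Qed.

Let cvg_scale_vec (a : Z -> R) (a0 : R) (v : Z -> 'rV[R]_k.+1) (v0 : 'rV[R]_k.+1) :
  a @ F --> a0 -> v @ F --> v0 -> a z *: v z @[z --> F] --> a0 *: v0.
Proof. exact: cvgZ. Qed.

Lemma cvg_short_vec : short_vec (f z) (g z) (h z) @[z --> F] --> short_vec x y t.
Proof.
have qc : 1 - before (h z) - after (h z) @[z --> F] --> 1 - before t - after t.
  by apply: cvgB => //; apply: cvgB => //; exact: cvg_cst.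
apply: cvgD; first apply: cvgD.
- apply: cvg_scale_vec; last exact: cvg_vec.
  by apply: cvgD => //; apply: cvgM => //; exact: cvg_height.
- apply: cvg_scale_vec; last exact: cvg_vec.
  by apply: cvgD => //; apply: cvgM => //; exact: cvg_height.
apply: cvg_scale_vec; last exact: cvg_cst.
apply: cvgM => //; apply: cvg_maxr; first exact: cvg_cst.
by apply: cvgB; [apply: cvgB; [exact: cvg_cst|exact: cvg_height]|exact: cvg_height].
Qed.

Lemma cvg_long_vec : x <> y ->
  long_vec (f z) (g z) (h z) @[z --> F] --> long_vec x y t.
Proof.
move=> xy.
have tc : long_time (f z) (g z) (h z) @[z --> F] --> long_time x y t.
  apply: cvgM; first exact: cvg_cst.
  apply: cvgM.
    apply: cvgD; apply: cvgM; [|exact: cvg_height|exact: cvg_after|exact: cvg_height].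
    by apply: cvgB => //; exact: cvg_cst.
  apply: cvg_invr; first by rewrite gt_eqF // height_sum_gt0.
  by apply: cvgD; exact: cvg_height.
apply: cvgD; first apply: cvgD.
- apply: cvg_scale_vec; last exact: cvg_vec.
  by apply: cvg_maxr; apply: cvgB => //; exact: cvg_cst.
- apply: cvg_scale_vec; last by apply: cvg_rot90; exact: cvg_vec.
  apply: cvg_maxr; first exact: cvg_cst.
  apply: cvgB; first exact: cvg_cst.
  by apply: cvg_norm; apply: cvgB => //; exact: cvg_cst.
apply: cvg_scale_vec; last exact: cvg_vec.
by apply: cvg_maxr; [exact: cvg_cst|apply: cvgB => //; exact: cvg_cst].
Qed.

Lemma cvg_plan b : 0 <= t <= 1 -> plan_dom b x y ->
  plan b (f z) (g z) (h z) @[z --> F] --> plan b x y t.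
Proof.
case: b => t01 dom; apply: cvg_normalize.
- exact: short_vec_neq0.
- exact: cvg_short_vec.
- exact: long_vec_neq0.
- exact: cvg_long_vec.
Qed.

End CvgPlan.

End Planner.

(** * The upper bound *)

Section Patterns.
Variables (n s : nat).
Local Notation pattern := {set 'I_n * 'I_s * 'I_s}.
Implicit Types S : pattern.

Definition equiv_pattern S := forall i, equivalence_rel (fun l m => (i, l, m) \in S).

(** For an equivalence pattern these are the least elements of the classes not containing the index
    0, in each coordinate. *)
Definition firsts S : {set 'I_n * 'I_s} :=
  [set il : 'I_n * 'I_s | (0 < il.2)%N &&
    [forall m : 'I_s, (m < il.2)%N ==> ((il.1, il.2, m) \notin S)]]%SET.

Definition pattern_rank S := #|firsts S|.

Lemma firstsP S i (l : 'I_s) : reflect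
  ((0 < l)%N /\ forall m : 'I_s, (m < l)%N -> (i, l, m) \notin S)
  ((i, l) \in firsts S).
Proof.
rewrite inE /=; apply: (iffP andP) => -[l0 H]; split=> //.
  by move=> m ml; move/forallP/(_ m)/implyP : H; apply.
by apply/forallP => m; apply/implyP; exact: H.
Qed.

(* Equivalent indices have equivalent least representatives, and the least
   representatives other than 0 are the [firsts]. *)
Lemma pattern_eq S S' : equiv_pattern S -> equiv_pattern S' -> S \subset S' ->
  pattern_rank S = pattern_rank S' -> S = S'.
Proof.
move=> eS eS' SS' rk; apply/eqP; rewrite finset.eqEsubset SS' /=.
have firstsE : firsts S' = firsts S.
  apply/eqP; rewrite eqEcard -/(pattern_rank S) rk leqnn andbT.
  apply/fintype.subsetP => -[i l] /firstsP[l0 H]; apply/firstsP; split=> // m ml.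
  by apply: contra (H m ml); exact: (fintype.subsetP SS').
have symS i l m : (i, l, m) \in S -> (i, m, l) \in S.
  by move=> lm; rewrite -((eS i _ _ _).2 lm) (eS i l l l).1.
have rep i l : exists l1, (i, l, l1) \in S /\ forall m : 'I_s, (m < l1)%N -> (i, l1, m) \notin S.
  have [l1 /= ll1 l1min] := @arg_minnP _ l (fun m => (i, l, m) \in S) val (eS i l l l).1.
  exists l1; split=> // m ml1; apply/negP => l1m.
  by have := l1min m; rewrite leqNgt ml1 ((eS i _ _ _).2 ll1) => /(_ l1m).
have subS' i l m : (i, l, m) \in S -> (i, l, m) \in S' by exact: (fintype.subsetP SS').
apply/fintype.subsetP => -[[i l] m] lmS'.
have [l1 [ll1 l1min]] := rep i l; have [m1 [mm1 m1min]] := rep i m.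
have l1m1 : (i, l1, m1) \in S'.
  rewrite -((eS' i _ _ _).2 (subS' _ _ _ ll1)).
  by rewrite ((eS' i _ _ _).2 lmS'); exact: subS'.
suff E : l1 = m1 by rewrite ((eS i _ _ _).2 ll1) E; exact: symS.
have no (a b : 'I_s) : (b < a)%N ->
    (forall m : 'I_s, (m < a)%N -> (i, a, m) \notin S) -> (i, a, b) \notin S'.
  move=> ba amin; have : (i, a) \in firsts S.
    by apply/firstsP; split=> //; apply: leq_ltn_trans ba.
  by rewrite -firstsE => /firstsP[_]; apply.
apply/val_inj; case: (ltngtP l1 m1) => // [lm|ml].
  by have := no m1 l1 lm m1min; rewrite -((eS' i _ _ _).2 l1m1) (eS' i l1 l1 l1).1.
by have := no l1 m1 ml l1min; rewrite l1m1.
Qed.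

End Patterns.

(** * Open strata of tuples and their motion planners *)

Section UpperBound.
Variables (R : realType) (s n : nat) (k : 'I_n -> nat).
Variables (e0 : forall i : 'I_n, sphere R (k i)) (X : set (sphere_product R k)).
Hypothesis kodd : forall i, odd (k i).
Hypothesis subX : is_subcomplex e0 X.
Hypothesis s0 : (0 < s)%N.

Local Notation Y := (cartesian_power s (set_type X)).
Local Notation pattern := {set 'I_n * 'I_s * 'I_s}.
Implicit Types (S : pattern) (z : Y).

Definition coord z l i : sphere R (k i) := set_val (z l) i.

Lemma power_coord_continuous l i : continuous (fun z => coord z l i).
Proof.
move=> z; refine (@cvg_for _ _ (fun x : sphere_product R k => x i) _ (nbhs z)
  (fun z => set_val (z l)) _ (@prod_coord_continuous _ _ _ _) _).
refine (@cvg_for _ _ set_val _ (nbhs z) (fun z => z l) _ (@set_val_continuous _ _ _) _).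
exact: (@prod_coord_continuous _ (fun=> set_type X) l z).
Qed.

(** Half the squared distance between two entries of a coordinate. *)
Definition gap z (c : 'I_n * 'I_s * 'I_s) : R :=
  1 - dot (set_val (coord z c.1.2 c.1.1)) (set_val (coord z c.2 c.1.1)).

Lemma gap_continuous c : continuous (gap^~ c).
Proof.
move=> z; apply: (@cvgB _ _ _ (nbhs z)); first exact: cvg_cst.
apply: (@cvg_dot _ _ _ (nbhs z)).
  refine (@cvg_for _ _ set_val _ (nbhs z) (fun z => coord z c.1.2 c.1.1) _
    (@set_val_continuous _ _ _) _).
  exact: power_coord_continuous.
refine (@cvg_for _ _ set_val _ (nbhs z) (fun z => coord z c.2 c.1.1) _
  (@set_val_continuous _ _ _) _).
exact: power_coord_continuous.
Qed.

Lemma gap_eq z i l m : coord z l i = coord z m i -> gap z (i, l, m) = 0.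
Proof. by rewrite /gap /= => ->; rewrite dotvv sqn_sphere subrr. Qed.

Lemma gap_gt0 z i l m : coord z l i <> coord z m i -> 0 < gap z (i, l, m).
Proof. by move/dot_sphere_lt1; rewrite subr_gt0. Qed.

(** An open condition valid at tuples with equality pattern [S]. Gaps below 1 exclude antipodal
    entries; comparing gaps inside and outside [S] separates patterns that are not nested. *)
Definition in_stratum S z :=
  [forall c, (c \in S) ==> (gap z c < 1) && [forall c', (c' \notin S) ==> (gap z c < gap z c')]].

Lemma in_stratumP S z : reflect
  ((forall c, c \in S -> gap z c < 1) /\
   (forall c c', c \in S -> c' \notin S -> gap z c < gap z c'))
  (in_stratum S z).
Proof.
apply: (iffP forallP) => [H|[H1 H2] c].
  split=> [c cS|c c' cS c'S]; have := H c; rewrite cS /= => /andP[// _ /forallP/(_ c')].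
  by rewrite c'S.
apply/implyP => cS; rewrite H1 //=; apply/forallP => c'; apply/implyP => c'S.
exact: H2.
Qed.

Lemma near_stratum S z : in_stratum S z -> \forall z' \near z, in_stratum S z'.
Proof.
move=> zS.
suff : \forall z' \near z, forall c, (c \in S) ==>
    (gap z' c < 1) && [forall c', (c' \notin S) ==> (gap z' c < gap z' c')].
  by apply: (@filterS _ (nbhs z)) => z' H; apply/forallP.
apply: (@filter_forall _ _ _ (nbhs z)) => c.
have := forallP zS c; case: (c \in S) => /=; last by move=> _; exact: (@nearW _ (nbhs z)).
move=> /andP[c1 cc']; rewrite near_simpl.
have n1 : \forall z' \near z, gap z' c < 1.
  exact: (cvgr_lt (gap z c) (@gap_continuous c z) _ c1).
suff n2 : \forall z' \near z, [forall c', (c' \notin S) ==> (gap z' c < gap z' c')].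
  by apply: (@filterS2 _ (nbhs z) _ _ _ _ _ n1 n2) => z' -> ->.
have : \forall z' \near z, forall c', (c' \notin S) ==> (gap z' c < gap z' c').
  apply: (@filter_forall _ _ _ (nbhs z)) => c'.
  have := forallP cc' c'; case: (c' \notin S) => /=; last by move=> _; exact: (@nearW _ (nbhs z)).
  rewrite -subr_gt0 => cc'0.
  have : \forall z' \near z, 0 < gap z' c' - gap z' c.
    have cg : gap z' c' - gap z' c @[z' --> z] --> gap z c' - gap z c.
      by apply: (@cvgB _ _ _ (nbhs z)); exact: gap_continuous.
    exact: (cvgr_gt (gap z c' - gap z c) cg _ cc'0).
  by apply: (@filterS _ (nbhs z)) => z'; rewrite subr_gt0.
by apply: (@filterS _ (nbhs z)) => z' H; apply/forallP.
Qed.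

(** If neither pattern contained the other, two triples would each have the smaller gap; nested
    patterns of equal rank coincide. *)
Lemma stratum_unique S S' z : equiv_pattern S -> equiv_pattern S' ->
  pattern_rank S = pattern_rank S' -> in_stratum S z -> in_stratum S' z -> S = S'.
Proof.
move=> eS eS' rk /in_stratumP[_ H] /in_stratumP[_ H'].
have [SS'|/fintype.subsetPn[c cS cS']] := boolP (S \subset S'); first exact: pattern_eq.
have [S'S|/fintype.subsetPn[c' c'S' c'S]] := boolP (S' \subset S).
  by apply/esym; exact: pattern_eq.
by have := lt_trans (H _ _ cS c'S) (H' _ _ c'S' cS'); rewrite ltxx.
Qed.

Definition eq_pattern z : pattern :=
  [set c | coord z c.1.2 c.1.1 == coord z c.2 c.1.1]%SET.

Lemma equiv_eq_pattern z : equiv_pattern (eq_pattern z).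
Proof. by move=> i l m q; rewrite !inE /= eqxx; split=> // /eqP ->. Qed.

Lemma in_stratum_eq_pattern z : in_stratum (eq_pattern z) z.
Proof.
apply/in_stratumP; split=> [[[i l] m]|[[i l] m] [[i' l'] m']]; rewrite !inE /=.
  by move=> /eqP/gap_eq ->.
by move=> /eqP/gap_eq -> /eqP/gap_gt0.
Qed.

(** If [(i, l)] is a first occurrence, either [i] is in the support [J l], or the entry is the base
    point and, being new, [i] lies in all earlier supports. Either way one term of the norm counts
    it. *)
Lemma rank_eq_pattern z : (pattern_rank (eq_pattern z) <= normX e0 s X)%N.
Proof.
pose J : {ffun 'I_s -> {set 'I_n}} := [ffun l => supp e0 (set_val (z l))].
have JK : [forall l, J l \in index_complex e0 X].
  by apply/forallP => l; rewrite ffunE; apply: supp_index => //; exact: set_valP.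
apply: leq_trans (leq_bigmax_cond _ JK); rewrite /normJ /pattern_rank.
rewrite card_sum_mem
  (eq_bigr (fun p : 'I_n * 'I_s => ((p.1, p.2) \in firsts (eq_pattern z) : nat)));
  last by case.
rewrite -(pair_bigA _ (fun i l => ((i, l) \in firsts (eq_pattern z) : nat))) /= exchange_big /=.
rewrite (bigID (fun l : 'I_s => (0 < l)%N)) /= addnC big1 ?add0n => [|l l0]; last first.
  by apply: big1 => i _; rewrite inE /= (negbTE l0).
apply: leq_sum => l l0; rewrite !card_sum_mem -big_split /=; apply: leq_sum => i _.
case: (boolP (_ \in firsts _)) => // /firstsP[_ H].
have [iJ|iJ] := boolP (i \in J l); first by rewrite addn1.
rewrite addn0 (_ : _ \in _ = true) //; apply/finset.setDP; split=> //.
apply/finset.bigcapP => m ml; rewrite ffunE inE.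
apply: contra (H m ml) => /eqP zm; move: iJ; rewrite ffunE inE negbK => /eqP zl.
by rewrite inE /= /coord zl zm.
Qed.

Definition rank_stratum (j : nat) : set Y :=
  [set z | exists S, [/\ equiv_pattern S, pattern_rank S = j & in_stratum S z]].

Lemma open_rank_stratum j : open (rank_stratum j).
Proof.
rewrite openE => z [S [eS rS zS]]; apply: (@filterS _ (nbhs z) _ _ _ _ (near_stratum zS)).
by move=> z' z'S; exists S.
Qed.

Lemma rank_stratum_cover z : rank_stratum (pattern_rank (eq_pattern z)) z.
Proof. by exists (eq_pattern z); split; [exact: equiv_eq_pattern| |exact: in_stratum_eq_pattern]. Qed.

Let l0 : 'I_s := Ordinal s0.

Definition planned_path z (b : 'I_n -> 'I_s -> bool) (l : 'I_s) (t : unit_interval R) :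
    sphere_product R k :=
  fun i => plan (e0 i) (b i l) (coord z l0 i) (coord z l i) (set_val t).

Lemma unit_interval_itv (t : unit_interval R) : 0 <= set_val t <= 1.
Proof. by have := set_valP t; rewrite /= in_itv. Qed.

(** The support lies in that of the starting point up to time 1/2 and in that of the endpoint
    afterwards; [X] contains every point with such a support. *)
Lemma planned_path_in z b l t : X (planned_path z b l t).
Proof.
have sub m (H : forall i, coord z m i = e0 i -> planned_path z b l t i = e0 i) :
    X (planned_path z b l t).
  apply: (index_sub kodd subX (supp_index subX (set_valP (z m)))).
  by apply/fintype.subsetP => i; rewrite !inE; apply: contra => /eqP/H ->.
have t01 := unit_interval_itv t.
have [th|/ltW th] := leP (set_val t) 2^-1; [apply: (sub l0)|apply: (sub l)] => i ze.
  by rewrite /planned_path ze plan_base_start.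
by rewrite /planned_path ze plan_base_end.
Qed.

Lemma has_continuousType (A B : topologicalType) (f : A -> B) : continuous f ->
  exists g : continuousType A B, (g : A -> B) = f.
Proof.
move=> fc; exists (HB.pack_for (continuousType A B) f (isContinuous.Build A B f fc)).
by [].
Qed.

Lemma rank_stratum_section j : has_section_on R (rank_stratum j).
Proof.
have /choice[pat patP] : forall z : set_type (rank_stratum j), exists S,
    [/\ equiv_pattern S, pattern_rank S = j & in_stratum S (set_val z)].
  by move=> z; exact: (set_valP z).
pose D := set_type (rank_stratum j).
pose flag (z : D) i (l : 'I_s) := (i, l0, l) \in pat z.
have flag_dom (z : D) i l : plan_dom (flag z i l) (coord (set_val z) l0 i) (coord (set_val z) l i).
  have [eS _ /in_stratumP[S1 S2]] := patP z.
  rewrite /flag; have [inS|ninS] := boolP ((i, l0, l) \in pat z).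
    by have := S1 _ inS; rewrite /gap /=; lra.
  (* The reflexive triple belongs to the pattern and has gap 0, so a triple outside has positive gap
     and its entries differ. *)
  have := S2 _ _ (eS i l0 l0 l0).1 ninS; rewrite gap_eq // => H E.
  by rewrite gap_eq ?ltxx in H.
(* Uniqueness makes the chosen pattern locally constant, hence also the choice between short and
   long motions. *)
have near_pat (z : D) : \forall z' \near z, pat z' = pat z.
  have [eS rS zS] := patP z.
  have : \forall z' \near z, in_stratum (pat z) (set_val z').
    exact: (set_val_continuous (near_stratum zS)).
  apply: (@filterS _ (nbhs z)) => z' z'S; have [eS' rS' z'S'] := patP z'.
  by apply: stratum_unique z'S' z'S => //; rewrite rS.
pose kk l (z : D) t : set_type X := SigSub (mem_set (planned_path_in (set_val z) (flag z) l t)).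
have kkc l : continuous (uncurry (kk l)).
  move=> [z t]; apply: (@cvg_set_type _ _ _ (nbhs (z, t))).
  apply: (@cvg_prod_topology _ _ _ (nbhs (z, t))) => i.
  pose g (zt : D * unit_interval R) :=
    plan (e0 i) (flag z i l) (coord (set_val zt.1) l0 i) (coord (set_val zt.1) l i) (set_val zt.2).
  apply: (@cvg_trans _ (g @ nbhs (z, t))).
    apply: (@near_eq_cvg _ _ (nbhs (z, t))).
    exists ([set z' | pat z' = pat z], setT); first by split=> /=; [exact: near_pat|exact: filterT].
    by move=> [z' t'] [/= pz _]; rewrite /g /flag /= -pz.
  have cc m : coord (set_val (zt : D * unit_interval R).1) m i @[zt --> (z, t)] -->
      coord (set_val z) m i.
    refine (@cvg_for _ _ (fun z => coord z m i) _ (nbhs (z, t))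
      (fun zt : D * unit_interval R => set_val zt.1) _
      (@power_coord_continuous _ _ _) _).
    refine (@cvg_for _ _ set_val _ (nbhs (z, t)) fst _ (@set_val_continuous _ _ _) _).
    exact: cvg_fst.
  apply: (@cvg_plan _ _ _ (kodd i) _ (nbhs (z, t))).
  - exact: cc.
  - exact: cc.
  - refine (@cvg_for _ _ set_val _ (nbhs (z, t)) snd _ (@set_val_continuous _ _ _) _).
    exact: cvg_snd.
  - exact: unit_interval_itv.
  - exact: flag_dom.
have kk0 (z : D) l l' : kk l z (unit_interval0 R) = kk l' z (unit_interval0 R).
  apply: val_inj; apply: functional_extensionality_dep => i /=.
  by rewrite /planned_path /= !plan0.
have clp (l : 'I_s) : closed [set unit_interval0 R].
  exact/accessible_closed_set1/hausdorff_accessible/unit_interval_hausdorff.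
(* The arms agree at time 0 and glue to a jointly continuous map on the wedge; currying turns it
   into a continuous family of multipaths. *)
have Fc := @wedge_fun_joint_continuous _ (fun=> unit_interval R) (fun=> unit_interval0 R)
  D _ kk (@finite_finset _ _) clp kk0 kkc.
have [Gc Gzc] := continuous_curry Fc.
have /choice[sg sgE] := fun z : D => has_continuousType (Gzc z).
exists sg; first apply: continuous_comp_initial.
  move: Gc; rewrite (_ : curry _ = fun z : D => (sg z : interval_wedge R s -> set_type X)) //.
  by apply/funext => z; rewrite sgE.
move=> z; apply/funext => l; rewrite /endpoints sgE /=.
rewrite /curry /= wedge_lift_funE; last by move=> ? ?; exact: kk0.
apply: val_inj; apply: functional_extensionality_dep => i /=.
by rewrite /planned_path /= plan1.
Qed.

Lemma cover_normX : motion_planning_cover R s (set_type X) (normX e0 s X).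
Proof.
exists (fun j => rank_stratum j); split=> [j||j].
- exact: open_rank_stratum.
- apply/seteqP; split=> // z _.
  have rz : (pattern_rank (eq_pattern z) < (normX e0 s X).+1)%N by rewrite ltnS rank_eq_pattern.
  by exists (Ordinal rz) => //; exact: rank_stratum_cover.
- exact: rank_stratum_section.
Qed.

End UpperBound.

Theorem theorem2p7 (R : realType) (s n : nat) (k : 'I_n -> nat)
    (e0 : forall i : 'I_n, sphere R (k i)) (X : set (sphere_product R k)) :
  (2 <= s)%N ->
  (forall i : 'I_n, odd (k i)) ->
  is_subcomplex e0 X ->
  is_TC R s (set_type X) (normX e0 s X).
Proof.
move=> s2 kodd subX; split; first by apply: cover_normX => //; exact: ltnW.
by move=> m; exact: normX_le_of_cover.
Qed.
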